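(* Let $\Bbbk$ be a field of characteristic zero and $\theta\in\Bbbk$. In the operad $\mathrm{RatFct}^\theta$ defined in the context, the operations \[ \mu:=1\in\mathrm{RatFct}^\theta(2)\quad\text{and}\quad R:=\frac1{x_1}\in\mathrm{RatFct}^\theta(1) \] satisfy the identities of (commutative) Rota--Baxter algebras of weight $\theta$. Moreover, they do not satisfy any further identities: the suboperad of $\mathrm{RatFct}^\theta$ generated by $\mu$ and $R$ is isomorphic to $\mathrm{RB}^\theta$, via the morphism of operads $\mathrm{RB}^\theta\to\mathrm{RatFct}^\theta$ sending the commutative product to $\mu$ and the Rota--Baxter operator to $R$.
   Context: A (commutative) Rota--Baxter algebra of weight $\theta$ is a vector space with a commutative associative product and a linear endomorphism $R$ satisfying $R(a)R(b)=R(R(a)b+aR(b)+\theta ab)$. $\mathrm{RB}^\theta$ denotes the symmetric operad governing such algebras (generated by a unary operation $R$ and a commutative associative binary operation, subject to this identity). The symmetric operad $\mathrm{RatFct}^\theta$ has components $\mathrm{RatFct}^\theta(n)=\Bbbk(x_1,\dots,x_n)$, $n\ge1$, with the symmetric group permuting the variables. Let $F^\theta(x_1,x_2)=x_1+x_2+\theta x_1x_2$, and let $F^\theta_n(x_1,\dots,x_n)=F^\theta(F^\theta(\cdots F^\theta(F^\theta(x_1,x_2),x_3),\cdots),x_n)$, with $F^\theta_1(x_1)=x_1$. For $f\in\mathrm{RatFct}^\theta(m)$, $g\in\mathrm{RatFct}^\theta(n)$ and $1\le i\le m$, \[ (f\circ_i g)(x_1,\dots,x_{m+n-1})=f\big(x_1,\dots,x_{i-1},F^\theta_n(x_i,\dots,x_{i+n-1}),x_{i+n},\dots,x_{m+n-1}\big)\,g(x_i,\dots,x_{i+n-1}).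 \] For $\theta=0$ this is Loday's operad of rational functions. *)

(* Defs.v *)
From HB Require Import structures.
From mathcomp Require Import all_boot all_order all_algebra all_fingroup.
From mathcomp Require Import zify ring.
From mathcomp Require Import generic_quotient boolp.
From mathcomp Require Import mpoly.

Set Implicit Arguments.
Unset Strict Implicit.
Unset Printing Implicit Defensive.

Import GRing.Theory.
Local Open Scope ring_scope.

(* The operads here have no operations of arity 0.                            *)
(* ARITIES ARE SHIFTED BY ONE: the component [P n] of an operad [P] consists  *)
(* of the operations with [n.+1] inputs, labelled by 0, ..., n.  Composing    *)
(* m.+1 inputs with n.+1 inputs leaves (m + n).+1 inputs.                     *)
(*                                                                            *)
(* Permutations act on the right by relabelling: input j of [x] becomes input *)
(* [s j] of [op_act s x].  In MathComp, (s * t) j = t (s j), which makes this *)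
(* a right action of 'S_n.+1.                                                 *)

(* In a partial composite [x o_i y], with y of n.+1 inputs, input l of y      *)
(* becomes input i + l, and input j != i of x becomes input [outer n i j].    *)
Definition outer (n i j : nat) : nat := if (j < i)%N then j else (j + n)%N.

(* [u] is the permutation of the inputs of a composite [x o_i y] induced by   *)
(* the permutations [s] and [t] of the inputs of x and y; these conditions    *)
(* determine it.                                                              *)
Definition is_block_perm (m n : nat) (i : 'I_m.+1) (s : 'S_m.+1) (t : 'S_n.+1)
    (u : 'S_(m + n).+1) : Prop :=
  (forall j : 'I_m.+1, j != i ->
     u (inord (outer n i j)) = outer n (s i) (s j) :> nat) /\
  (forall l : 'I_n.+1, u (inord (i + l)) = (s i + t l)%N :> nat).

Lemma is_block_perm_exists (m n : nat) (i : 'I_m.+1) (s : 'S_m.+1)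
    (t : 'S_n.+1) : exists u : 'S_(m + n).+1, is_block_perm i s t u.
Proof.
pose a q : nat := s (inord q); pose b q : nat := t (inord q).
have a_lt q : (a q < m.+1)%N by apply: ltn_ord.
have b_lt q : (b q < n.+1)%N by apply: ltn_ord.
have a_inj q q' : (q <= m)%N -> (q' <= m)%N -> a q = a q' -> q = q'.
  by move=> qm qm' /val_inj/perm_inj/(congr1 val); rewrite /= !inordK.
have b_inj q q' : (q <= n)%N -> (q' <= n)%N -> b q = b q' -> q = q'.
  by move=> qn qn' /val_inj/perm_inj/(congr1 val); rewrite /= !inordK.
pose w q : nat := if (q < i)%N then outer n (a i) (a q)
  else if (q <= i + n)%N then (a i + b (q - i))%N else outer n (a i) (a (q - n)%N).
have im := ltn_ord i.
have w_lt q : (w q < (m + n).+1)%N.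
  rewrite /w /outer; have := a_lt i; have := a_lt q; have := b_lt (q - i)%N.
  by have := a_lt (q - n)%N; do !case: ifP; lia.
have w_inj : injective (fun q : 'I_(m + n).+1 => inord (w q) : 'I_(m + n).+1).
  move=> q q' /(congr1 val); rewrite /= !inordK // => ww; apply: val_inj => /=.
  move: (nat_of_ord q) (ltn_ord q) (nat_of_ord q') (ltn_ord q') ww.
  move=> {}q qmn {}q' qmn'; rewrite /w.
  have := a_lt i.
  case: ifP => qi; [|case: ifP => qin]; (case: ifP => qi'; [|case: ifP => qin']).
  - by have := a_inj q q'; rewrite /outer; do !case: ifP; lia.
  - have := a_inj q i; have := b_lt (q' - i)%N.
    by rewrite /outer; do !case: ifP; lia.
  - by have := a_inj q (q' - n)%N; rewrite /outer; do !case: ifP; lia.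
  - have := a_inj q' i; have := b_lt (q - i)%N.
    by rewrite /outer; do !case: ifP; lia.
  - by have := b_inj (q - i)%N (q' - i)%N; lia.
  - have := a_inj (q' - n)%N i; have := b_lt (q - i)%N.
    by rewrite /outer; do !case: ifP; lia.
  - by have := a_inj (q - n)%N q'; rewrite /outer; do !case: ifP; lia.
  - have := a_inj (q - n)%N i; have := b_lt (q' - i)%N.
    by rewrite /outer; do !case: ifP; lia.
  - by have := a_inj (q - n)%N (q' - n)%N; rewrite /outer; do !case: ifP; lia.
exists (perm w_inj); split=> [j ji|l]; rewrite permE inordK //.
  have {ji}ji : (j : nat) <> i by move/val_inj => e; rewrite e eqxx in ji.
  have jm := ltn_ord j; have aE : a j = s j by rewrite /a inord_val.
  have aiE : a i = s i by rewrite /a inord_val.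
  have -> : (inord (outer n i j) : 'I_(m + n).+1) = outer n i j :> nat.
    by rewrite inordK // /outer; case: ifP; lia.
  rewrite /w -aE -aiE /outer; case: (ltnP j i) => ij; first by rewrite ij.
  have -> : (j + n < i)%N = false by lia.
  have -> : (j + n <= i + n)%N = false by lia.
  by rewrite addnK.
have ln := ltn_ord l; rewrite inordK; last by lia.
rewrite /w; have -> : (i + l < i)%N = false by lia.
have -> : (i + l <= i + n)%N by lia.
by rewrite addKn /a /b !inord_val.
Qed.

Record operad (k : fieldType) := Operad {
  op_car :> nat -> lmodType k;
  op_id : op_car 0;
  op_act : forall n, 'S_n.+1 -> op_car n -> op_car n;
  op_comp : forall m n, 'I_m.+1 -> op_car m -> op_car n -> op_car (m + n);
  op_act_linear : forall n (s : 'S_n.+1), linear (op_act s);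
  op_act1 : forall n (x : op_car n), op_act 1%g x = x;
  op_actM : forall n (s t : 'S_n.+1) (x : op_car n),
    op_act (s * t)%g x = op_act t (op_act s x);
  op_comp_linear_l : forall m n (i : 'I_m.+1) (y : op_car n),
    linear (fun x : op_car m => op_comp i x y);
  op_comp_linear_r : forall m n (i : 'I_m.+1) (x : op_car m),
    linear (fun y : op_car n => op_comp i x y);
  op_comp_id_l : forall n (x : op_car n), op_comp ord0 op_id x = x;
  op_comp_id_r : forall n (i : 'I_n.+1) (x : op_car n),
    op_comp i x op_id = ecast l (op_car l) (esym (addn0 n)) x;
  op_comp_seq : forall m n p (i : 'I_m.+1) (j : 'I_n.+1)
      (x : op_car m) (y : op_car n) (z : op_car p),
    op_comp (inord (i + j)) (op_comp i x y) z =
    ecast l (op_car l) (addnA m n p) (op_comp i x (op_comp j y z));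
  op_comp_par : forall m n p (i j : 'I_m.+1)
      (x : op_car m) (y : op_car n) (z : op_car p), (i < j)%N ->
    op_comp (inord (outer n i j)) (op_comp i x y) z =
    ecast l (op_car l) (addnAC m p n)
      (op_comp (inord (outer p j i)) (op_comp j x z) y);
  op_comp_act : forall m n (i : 'I_m.+1) (s : 'S_m.+1) (t : 'S_n.+1)
      (u : 'S_(m + n).+1) (x : op_car m) (y : op_car n),
    is_block_perm i s t u ->
    op_comp (s i) (op_act s x) (op_act t y) = op_act u (op_comp i x y) }.

Record operad_hom (k : fieldType) (P Q : operad k) := OperadHom {
  hom_fun :> forall n, P n -> Q n;
  hom_linear : forall n, linear (hom_fun (n := n));
  hom_id : hom_fun (op_id P) = op_id Q;
  hom_act : forall n (s : 'S_n.+1) (x : P n),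
    hom_fun (op_act s x) = op_act s (hom_fun x);
  hom_comp : forall m n (i : 'I_m.+1) (x : P m) (y : P n),
    hom_fun (op_comp i x y) = op_comp i (hom_fun x) (hom_fun y) }.

Definition operad_iso (k : fieldType) (P Q : operad k) (f : operad_hom P Q) :=
  forall n, bijective (f n).

Record suboperad (k : fieldType) (P : operad k) := Suboperad {
  sub_mem :> forall n, P n -> Prop;
  sub_0 : forall n, sub_mem (0 : P n);
  sub_lin : forall n (a : k) (x y : P n),
    sub_mem x -> sub_mem y -> sub_mem (a *: x + y);
  sub_id : sub_mem (op_id P);
  sub_act : forall n (s : 'S_n.+1) (x : P n), sub_mem x -> sub_mem (op_act s x);
  sub_comp : forall m n (i : 'I_m.+1) (x : P m) (y : P n),
    sub_mem x -> sub_mem y -> sub_mem (op_comp i x y) }.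

Section SubOperad.
Variables (k : fieldType) (P : operad k) (S : suboperad P).

Definition sub_pred n : {pred P n} := fun x => `[< S n x >].
Arguments sub_pred n : clear implicits.

Lemma sub_pred_closed n : submod_closed (sub_pred n).
Proof.
split=> [|a x y /asboolP Sx /asboolP Sy]; apply/asboolP; first exact: sub_0.
exact: sub_lin.
Qed.

HB.instance Definition _ n :=
  GRing.isSubmodClosed.Build k (P n) (sub_pred n) (sub_pred_closed n).

Record sub_car n := SubCar { sub_val :> P n; _ : sub_val \in sub_pred n }.

HB.instance Definition _ n := [isSub for @sub_val n].
HB.instance Definition _ n := [Choice of sub_car n by <:].
HB.instance Definition _ n := [SubChoice_isSubLmodule of sub_car n by <:].

Lemma sub_carP n (x : sub_car n) : S n (val x).
Proof. by case: x => x /= /asboolP. Qed.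

Definition sub_in n (x : P n) (Sx : S n x) : sub_car n :=
  SubCar (introT (asboolP _) Sx).

Definition suboperad_id := sub_in (sub_id S).
Definition suboperad_act n (s : 'S_n.+1) (x : sub_car n) : sub_car n :=
  sub_in (sub_act s (sub_carP x)).
Definition suboperad_comp m n (i : 'I_m.+1) (x : sub_car m) (y : sub_car n) :
  sub_car (m + n) := sub_in (sub_comp i (sub_carP x) (sub_carP y)).

Lemma val_cast m n (e : m = n) (x : sub_car m) :
  val (ecast l (sub_car l) e x) = ecast l (P l) e (val x).
Proof. by case: n / e. Qed.

Definition suboperad_operad : operad k.
Proof.
refine (@Operad k (fun n => sub_car n : lmodType k)
  suboperad_id suboperad_act suboperad_comp _ _ _ _ _ _ _ _ _ _).
- by move=> n s a x y; apply: val_inj; rewrite /= op_act_linear.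
- by move=> n x; apply: val_inj; rewrite /= op_act1.
- by move=> n s t x; apply: val_inj; rewrite /= op_actM.
- move=> m n i z a x y; apply: val_inj.
  by rewrite /= (op_comp_linear_l i (val z)).
- move=> m n i z a x y; apply: val_inj.
  by rewrite /= (op_comp_linear_r i (val z)).
- by move=> n x; apply: val_inj; rewrite /= op_comp_id_l.
- by move=> n i x; apply: val_inj; rewrite val_cast /= op_comp_id_r.
- by move=> m n p i j x y z; apply: val_inj; rewrite val_cast /= op_comp_seq.
- by move=> m n p i j x y z ij; apply: val_inj; rewrite val_cast /= op_comp_par.
- by move=> m n i s t u x y ub; apply: val_inj; rewrite /= (op_comp_act _ _ ub).
Defined.

End SubOperad.

Section GeneratedSuboperad.
Variables (k : fieldType) (P : operad k) (G : nat -> Type).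
Variable g : forall n, G n -> P n.

Definition generated_by n (x : P n) : Prop :=
  forall S : suboperad P, (forall m (a : G m), S m (g a)) -> S n x.

Definition generated_suboperad : suboperad P.
Proof.
refine (@Suboperad k P generated_by _ _ _ _ _).
- by move=> n S _; exact: sub_0.
- by move=> n a x y Sx Sy S gS; apply: sub_lin; [exact: Sx | exact: Sy].
- by move=> S _; exact: sub_id.
- by move=> n s x Sx S gS; apply: sub_act; exact: Sx.
- by move=> m n i x y Sx Sy S gS; apply: sub_comp; [exact: Sx | exact: Sy].
Defined.

End GeneratedSuboperad.

Section Presentation.
Variables (k : fieldType) (G : nat -> Type).

Inductive term : nat -> Type :=
| Tgen n : G n -> term n
| Tid : term 0
| Tzero n : term n
| Tadd n : term n -> term n -> term n
| Tscale n : k -> term n -> term n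
| Tact n : 'S_n.+1 -> term n -> term n
| Tcomp m n : 'I_m.+1 -> term m -> term n -> term (m + n).

Arguments Tzero {n}.

Variable Rel : forall n, term n -> term n -> Prop.

(* The least congruence containing [Rel] and the axioms of operads: the       *)
(* quotient of [term] by it is the free symmetric operad on [G] modulo the    *)
(* operadic ideal generated by [Rel].                                         *)
Inductive cong : forall n, term n -> term n -> Prop :=
| cong_rel n (x y : term n) : Rel x y -> cong x y
| cong_refl n (x : term n) : cong x x
| cong_sym n (x y : term n) : cong x y -> cong y x
| cong_trans n (x y z : term n) : cong x y -> cong y z -> cong x z
| cong_add n (x x' y y' : term n) :
    cong x x' -> cong y y' -> cong (Tadd x y) (Tadd x' y')
| cong_scale n a (x x' : term n) : cong x x' -> cong (Tscale a x) (Tscale a x')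
| cong_act n s (x x' : term n) : cong x x' -> cong (Tact s x) (Tact s x')
| cong_comp m n (i : 'I_m.+1) (x x' : term m) (y y' : term n) :
    cong x x' -> cong y y' -> cong (Tcomp i x y) (Tcomp i x' y')
| cong_addA n (x y z : term n) :
    cong (Tadd x (Tadd y z)) (Tadd (Tadd x y) z)
| cong_addC n (x y : term n) : cong (Tadd x y) (Tadd y x)
| cong_add0 n (x : term n) : cong (Tadd Tzero x) x
| cong_addN n (x : term n) : cong (Tadd (Tscale (- 1) x) x) Tzero
| cong_scaleA n a b (x : term n) :
    cong (Tscale a (Tscale b x)) (Tscale (a * b) x)
| cong_scale1 n (x : term n) : cong (Tscale 1 x) x
| cong_scaleDr n a (x y : term n) :
    cong (Tscale a (Tadd x y)) (Tadd (Tscale a x) (Tscale a y))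
| cong_scaleDl n a b (x : term n) :
    cong (Tscale (a + b) x) (Tadd (Tscale a x) (Tscale b x))
| cong_act_linear n s a (x y : term n) :
    cong (Tact s (Tadd (Tscale a x) y)) (Tadd (Tscale a (Tact s x)) (Tact s y))
| cong_act1 n (x : term n) : cong (Tact 1%g x) x
| cong_actM n s t (x : term n) : cong (Tact (s * t)%g x) (Tact t (Tact s x))
| cong_comp_linear_l m n (i : 'I_m.+1) a (x x' : term m) (y : term n) :
    cong (Tcomp i (Tadd (Tscale a x) x') y)
         (Tadd (Tscale a (Tcomp i x y)) (Tcomp i x' y))
| cong_comp_linear_r m n (i : 'I_m.+1) a (x : term m) (y y' : term n) :
    cong (Tcomp i x (Tadd (Tscale a y) y'))
         (Tadd (Tscale a (Tcomp i x y)) (Tcomp i x y'))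
| cong_comp_id_l n (x : term n) : cong (Tcomp ord0 Tid x) x
| cong_comp_id_r n (i : 'I_n.+1) (x : term n) :
    cong (Tcomp i x Tid) (ecast l (term l) (esym (addn0 n)) x)
| cong_comp_seq m n p (i : 'I_m.+1) (j : 'I_n.+1)
    (x : term m) (y : term n) (z : term p) :
    cong (Tcomp (inord (i + j)) (Tcomp i x y) z)
         (ecast l (term l) (addnA m n p) (Tcomp i x (Tcomp j y z)))
| cong_comp_par m n p (i j : 'I_m.+1)
    (x : term m) (y : term n) (z : term p) : (i < j)%N ->
    cong (Tcomp (inord (outer n i j)) (Tcomp i x y) z)
         (ecast l (term l) (addnAC m p n)
           (Tcomp (inord (outer p j i)) (Tcomp j x z) y))
| cong_comp_act m n (i : 'I_m.+1) (s : 'S_m.+1) (t : 'S_n.+1)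
    (u : 'S_(m + n).+1) (x : term m) (y : term n) : is_block_perm i s t u ->
    cong (Tcomp (s i) (Tact s x) (Tact t y)) (Tact u (Tcomp i x y)).

Definition congb n : rel {classic term n} := fun x y => `[< cong x y >].

Lemma congb_refl n : reflexive (@congb n).
Proof. by move=> x; apply/asboolP/cong_refl. Qed.

Lemma congb_sym n : ssrbool.symmetric (@congb n).
Proof. by move=> x y; apply/asboolP/asboolP; exact: cong_sym. Qed.

Lemma congb_trans n : transitive (@congb n).
Proof.
move=> y x z /asboolP xy /asboolP yz; apply/asboolP; exact: cong_trans xy yz.
Qed.

Canonical congb_equiv n :=
  EquivRel (@congb n) (@congb_refl n) (@congb_sym n) (@congb_trans n).

Definition pres_car n := {eq_quot @congb n}%qT.

HB.instance Definition _ n := Choice.on (pres_car n).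

Definition pres_pi n (x : term n) : pres_car n := (\pi_(pres_car n) x)%qT.
Definition pres_repr n (x : pres_car n) : term n := repr x.

Lemma pres_piP n (x y : term n) : pres_pi x = pres_pi y <-> cong x y.
Proof. by split=> [/eqmodP/asboolP|xy] //; apply/eqmodP/asboolP. Qed.

Lemma pres_reprK n (x : pres_car n) : pres_pi (pres_repr x) = x.
Proof. exact: reprK. Qed.

Lemma cong_repr n (x : term n) : cong (pres_repr (pres_pi x)) x.
Proof. by apply/pres_piP; rewrite pres_reprK. Qed.

Lemma pres_ind n (Q : pres_car n -> Prop) :
  (forall x, Q (pres_pi x)) -> forall x, Q x.
Proof. by move=> h x; rewrite -[x]pres_reprK. Qed.

Definition pres_add n (x y : pres_car n) :=
  locked (pres_pi (Tadd (pres_repr x) (pres_repr y))).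
Definition pres_scale n a (x : pres_car n) :=
  locked (pres_pi (Tscale a (pres_repr x))).
Definition pres_opp n (x : pres_car n) := pres_scale (-1) x.
Definition pres_zero n : pres_car n := pres_pi Tzero.
Definition pres_id : pres_car 0 := pres_pi Tid.
Definition pres_act n (s : 'S_n.+1) (x : pres_car n) :=
  locked (pres_pi (Tact s (pres_repr x))).
Definition pres_comp m n (i : 'I_m.+1) (x : pres_car m) (y : pres_car n) :=
  locked (pres_pi (Tcomp i (pres_repr x) (pres_repr y))).

Lemma pi_add n (x y : term n) :
  pres_add (pres_pi x) (pres_pi y) = pres_pi (Tadd x y).
Proof. by rewrite /pres_add -lock; apply/pres_piP/cong_add; exact: cong_repr. Qed.
Lemma pi_scale n a (x : term n) :
  pres_scale a (pres_pi x) = pres_pi (Tscale a x).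
Proof. by rewrite /pres_scale -lock; apply/pres_piP/cong_scale; exact: cong_repr. Qed.
Lemma pi_act n s (x : term n) : pres_act s (pres_pi x) = pres_pi (Tact s x).
Proof. by rewrite /pres_act -lock; apply/pres_piP/cong_act; exact: cong_repr. Qed.
Lemma pi_comp m n (i : 'I_m.+1) (x : term m) (y : term n) :
  pres_comp i (pres_pi x) (pres_pi y) = pres_pi (Tcomp i x y).
Proof. by rewrite /pres_comp -lock; apply/pres_piP/cong_comp; exact: cong_repr. Qed.
Lemma pi_cast m n (e : m = n) (x : term m) :
  ecast l (pres_car l) e (pres_pi x) = pres_pi (ecast l (term l) e x).
Proof. by case: n / e. Qed.

Lemma pres_addA n : associative (@pres_add n).
Proof.
elim/pres_ind=> x; elim/pres_ind=> y; elim/pres_ind=> z; rewrite !pi_add.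
exact/pres_piP/cong_addA.
Qed.
Lemma pres_addC n : commutative (@pres_add n).
Proof.
elim/pres_ind=> x; elim/pres_ind=> y; rewrite !pi_add.
exact/pres_piP/cong_addC.
Qed.
Lemma pres_add0 n : left_id (@pres_zero n) (@pres_add n).
Proof. elim/pres_ind=> x; rewrite !pi_add; exact/pres_piP/cong_add0. Qed.
Lemma pres_addN n : left_inverse (@pres_zero n) (@pres_opp n) (@pres_add n).
Proof.
elim/pres_ind=> x; rewrite /pres_opp pi_scale pi_add.
exact/pres_piP/cong_addN.
Qed.

HB.instance Definition _ n := GRing.isZmodule.Build (pres_car n)
  (@pres_addA n) (@pres_addC n) (@pres_add0 n) (@pres_addN n).

Lemma piD n (x y : term n) : pres_pi x + pres_pi y = pres_pi (Tadd x y).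
Proof. exact: pi_add. Qed.

Lemma pres_scaleA n a b (x : pres_car n) :
  pres_scale a (pres_scale b x) = pres_scale (a * b) x.
Proof.
elim/pres_ind: x => x; rewrite !pi_scale; exact/pres_piP/cong_scaleA.
Qed.
Lemma pres_scale1 n : left_id 1 (@pres_scale n).
Proof. elim/pres_ind=> x; rewrite !pi_scale; exact/pres_piP/cong_scale1. Qed.
Lemma pres_scaleDr n : right_distributive (@pres_scale n) +%R.
Proof.
move=> a; elim/pres_ind=> x; elim/pres_ind=> y.
rewrite piD !pi_scale piD; exact/pres_piP/cong_scaleDr.
Qed.
Lemma pres_scaleDl n (x : pres_car n) :
  {morph (@pres_scale n)^~ x : a b / a + b}.
Proof.
move=> a b; elim/pres_ind: x => x.
rewrite !pi_scale piD; exact/pres_piP/cong_scaleDl.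
Qed.

HB.instance Definition _ n := GRing.Zmodule_isLmodule.Build k (pres_car n)
  (@pres_scaleA n) (@pres_scale1 n) (@pres_scaleDr n) (@pres_scaleDl n).

Lemma piZ n a (x : term n) : a *: pres_pi x = pres_pi (Tscale a x).
Proof. exact: pi_scale. Qed.
Let piE := (piD, piZ, pi_act, pi_comp, pi_cast).

Definition presented_operad : operad k.
Proof.
refine (@Operad k (fun n => pres_car n : lmodType k)
  pres_id pres_act pres_comp _ _ _ _ _ _ _ _ _ _).
- move=> n s a; elim/pres_ind=> x; elim/pres_ind=> y; rewrite !piE.
  exact/pres_piP/cong_act_linear.
- move=> n; elim/pres_ind=> x; rewrite !piE; exact/pres_piP/cong_act1.
- move=> n s t; elim/pres_ind=> x; rewrite !piE; exact/pres_piP/cong_actM.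
- move=> m n i; elim/pres_ind=> z a; elim/pres_ind=> x; elim/pres_ind=> y.
  rewrite !piE; exact/pres_piP/cong_comp_linear_l.
- move=> m n i; elim/pres_ind=> z a; elim/pres_ind=> x; elim/pres_ind=> y.
  rewrite !piE; exact/pres_piP/cong_comp_linear_r.
- move=> n; elim/pres_ind=> x; rewrite /pres_id !piE.
  exact/pres_piP/cong_comp_id_l.
- move=> n i; elim/pres_ind=> x; rewrite /pres_id !piE.
  exact/pres_piP/cong_comp_id_r.
- move=> m n p i j; elim/pres_ind=> x; elim/pres_ind=> y; elim/pres_ind=> z.
  rewrite !piE; exact/pres_piP/cong_comp_seq.
- move=> m n p i j; elim/pres_ind=> x; elim/pres_ind=> y; elim/pres_ind=> z ij.
  rewrite !piE; exact/pres_piP/cong_comp_par.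
- move=> m n i s t u; elim/pres_ind=> x; elim/pres_ind=> y ub.
  rewrite !piE; exact/pres_piP/cong_comp_act.
Defined.

Definition pres_gen n (a : G n) : presented_operad n := pres_pi (Tgen a).

Section UniversalProperty.
Variables (P : operad k) (g : forall n, G n -> P n).

Fixpoint term_eval n (x : term n) : P n :=
  match x in term l return P l with
  | Tgen _ a => g a
  | Tid => op_id P
  | Tzero _ => 0
  | Tadd _ x y => term_eval x + term_eval y
  | Tscale _ a x => a *: term_eval x
  | Tact _ s x => op_act s (term_eval x)
  | Tcomp _ _ i x y => op_comp i (term_eval x) (term_eval y)
  end.

Hypothesis g_rel : forall n (x y : term n),
  Rel x y -> term_eval x = term_eval y.

Lemma term_eval_cast m n (e : m = n) (x : term m) :
  term_eval (ecast l (term l) e x) = ecast l (P l) e (term_eval x).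
Proof. by case: n / e. Qed.

Lemma term_eval_cong n (x y : term n) : cong x y -> term_eval x = term_eval y.
Proof.
elim=> {n x y} //=.
- by move=> n x y z _ -> _ ->.
- by move=> n x x' y y' _ -> _ ->.
- by move=> n a x x' _ ->.
- by move=> n s x x' _ ->.
- by move=> m n i x x' y y' _ -> _ ->.
- by move=> n x y z; rewrite addrA.
- by move=> n x y; rewrite addrC.
- by move=> n x; rewrite add0r.
- by move=> n x; rewrite scaleN1r addNr.
- by move=> n a b x; rewrite scalerA.
- by move=> n x; rewrite scale1r.
- by move=> n a x y; rewrite scalerDr.
- by move=> n a b x; rewrite scalerDl.
- by move=> n s a x y; rewrite op_act_linear.
- by move=> n x; rewrite op_act1.
- by move=> n s t x; rewrite op_actM.
- by move=> m n i a x x' y; rewrite (op_comp_linear_l i (term_eval y)).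
- by move=> m n i a x y y'; rewrite (op_comp_linear_r i (term_eval x)).
- by move=> n x; rewrite op_comp_id_l.
- by move=> n i x; rewrite term_eval_cast op_comp_id_r.
- by move=> m n p i j x y z; rewrite term_eval_cast op_comp_seq.
- by move=> m n p i j x y z ij; rewrite term_eval_cast op_comp_par.
- by move=> m n i s t u x y ub; rewrite (op_comp_act _ _ ub).
Qed.

Definition pres_lift_fun n (x : presented_operad n) : P n :=
  term_eval (pres_repr x).

Lemma pres_lift_pi n (x : term n) : pres_lift_fun (pres_pi x) = term_eval x.
Proof. exact/term_eval_cong/cong_repr. Qed.

Definition pres_lift : operad_hom presented_operad P.
Proof.
refine (@OperadHom k presented_operad P pres_lift_fun _ _ _ _).
- move=> n a; elim/pres_ind=> x; elim/pres_ind=> y.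
  by rewrite !(piE, pres_lift_pi).
- exact: pres_lift_pi.
- by move=> n s; elim/pres_ind=> x; rewrite /= !(piE, pres_lift_pi).
- move=> m n i; elim/pres_ind=> x; elim/pres_ind=> y.
  by rewrite /= !(piE, pres_lift_pi).
Defined.

Lemma pres_lift_gen n (a : G n) : pres_lift n (pres_gen a) = g a.
Proof. exact: pres_lift_pi. Qed.

End UniversalProperty.

Lemma pres_hom_uniq (P : operad k) (f h : operad_hom presented_operad P) :
  (forall n (a : G n), f n (pres_gen a) = h n (pres_gen a)) ->
  forall n x, f n x = h n x.
Proof.
move=> fh n; elim/pres_ind=> x.
have f0 (f' : operad_hom presented_operad P) l : f' l 0 = 0.
  have := hom_linear f' (-1) (0 : presented_operad l) 0.
  by rewrite scaler0 addr0 scaleN1r addNr.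
have fD (f' : operad_hom presented_operad P) l x' y' :
    f' l (x' + y') = f' l x' + f' l y'.
  by have := hom_linear f' 1 x' y'; rewrite !scale1r.
have fZ (f' : operad_hom presented_operad P) l a x' :
    f' l (a *: x') = a *: f' l x'.
  by have := hom_linear f' a x' 0; rewrite f0 !addr0.
elim: x => {n}.
- exact: fh.
- by rewrite !hom_id.
- by move=> n; rewrite !f0.
- by move=> n x fx y fy; rewrite -piD !fD fx fy.
- by move=> n a x fx; rewrite -piZ !fZ fx.
- move=> n s x fx; rewrite -pi_act.
  by rewrite (hom_act f s (pres_pi x)) (hom_act h s (pres_pi x)) fx.
- move=> m n i x fx y fy; rewrite -pi_comp.
  rewrite (hom_comp f i (pres_pi x) (pres_pi y)).
  by rewrite (hom_comp h i (pres_pi x) (pres_pi y)) fx fy.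
Qed.

End Presentation.

(* The last equation is                                                       *)
(*   R(a1) R(a2) = R(R(a1) a2 + a1 R(a2) + theta a1 a2).                      *)
Definition is_rota_baxter (k : fieldType) (theta : k) (P : operad k)
    (mu : P 1) (R : P 0) : Prop :=
  [/\ op_act (tperm ord0 ord_max) mu = mu,
      op_comp ord0 mu mu = op_comp ord_max mu mu &
      op_comp ord0 (op_comp ord_max mu R) R =
      op_comp ord0 R (op_comp ord0 mu R) + op_comp ord0 R (op_comp ord_max mu R)
        + theta *: op_comp ord0 R mu].

Inductive RB_gen : nat -> Type :=
| RBmu : RB_gen 1
| RBop : RB_gen 0.

Inductive RB_rel (k : fieldType) (theta : k) :
  forall n, term k RB_gen n -> term k RB_gen n -> Prop :=
| RB_mulC :
    RB_rel theta (Tact (tperm ord0 ord_max) (Tgen k RBmu)) (Tgen k RBmu)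
| RB_mulA :
    RB_rel theta (n := 2)
      (Tcomp ord0 (Tgen k RBmu) (Tgen k RBmu))
      (Tcomp ord_max (Tgen k RBmu) (Tgen k RBmu))
| RB_rota_baxter :
    RB_rel theta (n := 1)
      (Tcomp ord0 (Tcomp ord_max (Tgen k RBmu) (Tgen k RBop)) (Tgen k RBop))
      (Tadd
        (Tadd (Tcomp ord0 (Tgen k RBop) (Tcomp ord0 (Tgen k RBmu) (Tgen k RBop)))
          (Tcomp ord0 (Tgen k RBop) (Tcomp ord_max (Tgen k RBmu) (Tgen k RBop))))
        (Tscale theta (Tcomp ord0 (Tgen k RBop) (Tgen k RBmu)))).

Definition RB (k : fieldType) (theta : k) : operad k :=
  presented_operad (@RB_rel k theta).

Definition RB_mul (k : fieldType) (theta : k) : RB theta 1 := pres_gen _ RBmu.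
Definition RB_op (k : fieldType) (theta : k) : RB theta 0 := pres_gen _ RBop.

Definition RB_family (k : fieldType) (P : operad k) (mu : P 1) (R : P 0)
    n (a : RB_gen n) : P n :=
  match a in RB_gen l return P l with RBmu => mu | RBop => R end.

Lemma RB_is_rota_baxter (k : fieldType) (theta : k) :
  is_rota_baxter theta (RB_mul theta) (RB_op theta).
Proof.
split; rewrite /RB_mul /RB_op /pres_gen /=.
- by rewrite pi_act; apply/pres_piP/cong_rel; constructor.
- by rewrite !pi_comp; apply/pres_piP/cong_rel; constructor.
- rewrite !pi_comp piZ !piD; apply/pres_piP/cong_rel; constructor.
Qed.

Lemma RB_universal (k : fieldType) (theta : k) (P : operad k)
    (mu : P 1) (R : P 0) : is_rota_baxter theta mu R ->
  exists2 phi : operad_hom (RB theta) P,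
    phi 1%N (RB_mul theta) = mu /\ phi 0%N (RB_op theta) = R &
    forall psi : operad_hom (RB theta) P,
      psi 1%N (RB_mul theta) = mu -> psi 0%N (RB_op theta) = R ->
      forall n x, psi n x = phi n x.
Proof.
move=> [mulC mulA rb].
have rel_ok n (x y : term k RB_gen n) : RB_rel theta x y ->
    term_eval (RB_family mu R) x = term_eval (RB_family mu R) y by case.
pose phi : operad_hom (RB theta) P := pres_lift rel_ok.
have phi_mu : phi 1%N (RB_mul theta) = mu := pres_lift_gen rel_ok RBmu.
have phi_R : phi 0%N (RB_op theta) = R := pres_lift_gen rel_ok RBop.
exists phi => // psi psi_mu psi_R; apply: pres_hom_uniq => n [].
  by rewrite -/(RB_mul theta) psi_mu.
by rewrite -/(RB_op theta) psi_R.
Qed.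

Section FormalGroupLaw.
Variables (K : comNzRingType) (t : K).

Implicit Types v w : nat -> K.

Definition fgl (x y : K) : K := x + y + t * x * y.

(* [fgl_iter v n] is F_(n+1)(v 0, ..., v n). *)
Fixpoint fgl_iter (v : nat -> K) (n : nat) : K :=
  if n is n'.+1 then fgl (fgl_iter v n') (v n) else v 0%N.

Lemma fglA : associative fgl. Proof. by move=> x y z; rewrite /fgl; ring. Qed.
Lemma fglC : commutative fgl. Proof. by move=> x y; rewrite /fgl; ring. Qed.
Lemma fgl0 : left_id 0 fgl. Proof. by move=> x; rewrite /fgl; ring. Qed.
HB.instance Definition _ := Monoid.isComLaw.Build K 0 fgl fglA fglC fgl0.

Lemma fgl_iterE v n : fgl_iter v n = \big[fgl/0]_(0 <= i < n.+1) v i.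
Proof.
elim: n => [|n IHn] /=; first by rewrite big_nat1.
by rewrite big_nat_recr //= IHn.
Qed.

Lemma eq_fgl_iter v w n :
  (forall i, (i <= n)%N -> v i = w i) -> fgl_iter v n = fgl_iter w n.
Proof.
by move=> vw; rewrite !fgl_iterE; apply: eq_big_nat => i /andP[_]; apply: vw.
Qed.

Lemma fgl_iter_perm v n (s : 'S_n.+1) :
  fgl_iter (fun l => v (s (inord l))) n = fgl_iter v n.
Proof.
rewrite !fgl_iterE !big_mkord [RHS](reindex_inj (@perm_inj _ s)).
by apply: eq_bigr => i _; rewrite inord_val.
Qed.

Lemma fgl_iter_nest v n p j : (j <= n)%N ->
  fgl_iter (fun l => if l == j then fgl_iter (fun q => v (j + q)%N) p
                     else v (outer p j l)) n = fgl_iter v (n + p).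
Proof.
move=> jn; rewrite !fgl_iterE.
rewrite (big_cat_nat (n := j)) ?leq0n //=; last by lia.
rewrite [RHS](big_cat_nat (n := j)) ?leq0n //=; last by lia.
congr fgl.
  apply: eq_big_nat => i /andP[_ ij]; rewrite /outer ij.
  by case: eqP => // e; lia.
rewrite big_ltn // eqxx.
rewrite [RHS](big_cat_nat (n := (p.+1 + j)%N)) /=; [|lia|lia].
congr fgl.
  rewrite -[in RHS](add0n j) [RHS]big_addn add0n addnK.
  by apply: eq_bigr => i _; rewrite addnC.
have -> : (p.+1 + j = j.+1 + p)%N by lia.
rewrite big_addn -addSn addnK; apply: eq_big_nat => i /andP[ij _].
rewrite /outer; case: eqP => [e|_]; first lia.
by case: ltnP => //; lia.
Qed.

End FormalGroupLaw.

Lemma rmorph_mmap (n : nat) (R S S' : comNzRingType) (f : {rmorphism R -> S})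
    (h : 'I_n -> S) (phi : {rmorphism S -> S'}) (p : {mpoly R[n]}) :
  phi (mmap f h p) = mmap (phi \o f) (phi \o h) p.
Proof.
rewrite /mmap rmorph_sum; apply: eq_bigr => m _.
rewrite rmorphM /mmap1 rmorph_prod; congr (_ * _).
by apply: eq_bigr => i _; rewrite rmorphXn.
Qed.

Lemma mmap_ext (n : nat) (R S : comNzRingType) (f f' : R -> S)
    (h h' : 'I_n -> S) (p : {mpoly R[n]}) :
  f =1 f' -> h =1 h' -> mmap f h p = mmap f' h' p.
Proof.
move=> ff hh; rewrite /mmap; apply: eq_bigr => m _; rewrite ff.
by congr (_ * _); apply: mmap1_eq.
Qed.

Lemma mmap_polyX (n : nat) (R : comNzRingType) (p : {mpoly R[n]}) :
  mmap (@mpolyC n R) (fun i => 'X_i) p = p.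
Proof.
rewrite {2}[p]mpolyE /mmap; apply: eq_bigr => m _.
by rewrite mmap1_id mul_mpolyC.
Qed.

Lemma rmorph_fgl_iter (K K' : comNzRingType) (phi : {rmorphism K -> K'}) t v n :
  phi (fgl_iter t v n) = fgl_iter (phi t) (phi \o v) n.
Proof. by elim: n => //= n IHn; rewrite /fgl !rmorphD !rmorphM IHn. Qed.

Lemma div_sub (F : fieldType) (a b c d : F) : b != 0 -> d != 0 ->
  (a * d - c * b) / (b * d) = a / b - c / d.
Proof. by move=> b0 d0; field; rewrite ?b0 ?d0. Qed.

Lemma sub_cross (F : comNzRingType) (x y b d : F) :
  (x - y) * (b * d) = x * b * d - y * d * b.
Proof. by ring. Qed.

Section RatFct.
Variable k : fieldType.

(* k(x_0, ..., x_n) *)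
Definition ratfct (n : nat) := {fraction {mpoly k[n.+1]}}.
HB.instance Definition _ n := GRing.Field.on (ratfct n).

Definition rf_poly n (p : {mpoly k[n.+1]}) : ratfct n := FracField.tofrac p.
HB.instance Definition _ n := GRing.RMorphism.copy (@rf_poly n)
  (@FracField.tofrac {mpoly k[n.+1]}).

Definition rf_const n (c : k) : ratfct n := rf_poly c%:MP.
HB.instance Definition _ n := GRing.RMorphism.copy (@rf_const n)
  (@rf_poly n \o @mpolyC n.+1 k).

(* The variable x_j, for j <= n. *)
Definition rf_var n (j : nat) : ratfct n := rf_poly 'X_(inord j).

Definition rf_scale n (c : k) (f : ratfct n) : ratfct n := rf_const n c * f.

Lemma rf_scaleA n a b (f : ratfct n) :
  rf_scale a (rf_scale b f) = rf_scale (a * b) f.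
Proof. by rewrite /rf_scale rmorphM mulrA. Qed.
Lemma rf_scale1 n : left_id 1 (@rf_scale n).
Proof. by move=> f; rewrite /rf_scale rmorph1 mul1r. Qed.
Lemma rf_scaleDr n : right_distributive (@rf_scale n) +%R.
Proof. by move=> a f g; rewrite /rf_scale mulrDr. Qed.
Lemma rf_scaleDl n (f : ratfct n) : {morph (@rf_scale n)^~ f : a b / a + b}.
Proof. by move=> a b; rewrite /rf_scale rmorphD mulrDl. Qed.

HB.instance Definition _ n := GRing.Zmodule_isLmodule.Build k (ratfct n)
  (@rf_scaleA n) (@rf_scale1 n) (@rf_scaleDr n) (@rf_scaleDl n).

Lemma rf_scaleE n a (f : ratfct n) : a *: f = rf_const n a * f.
Proof. by []. Qed.

(* f(v_0, ..., v_m), computed as p(v) / q(v) for a representative p / q of f. *)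
(* The value does not depend on the representative when v is algebraically    *)
(* independent ([rf_substE]), which is the case wherever it is used below.    *)
Definition rf_subst m n (v : 'I_m.+1 -> ratfct n) (f : ratfct m) : ratfct n :=
  mmap (@rf_const n) v \n_(repr f) / mmap (@rf_const n) v \d_(repr f).

Definition alg_indep m n (v : 'I_m.+1 -> ratfct n) :=
  forall p, mmap (@rf_const n) v p = 0 -> p = 0.

Lemma rf_poly_inj n : injective (@rf_poly n).
Proof. by move=> p q /eqP; rewrite tofrac_eq => /eqP. Qed.

Lemma rf_poly_eq0 n (p : {mpoly k[n.+1]}) : (rf_poly p == 0) = (p == 0).
Proof. exact: tofrac_eq0. Qed.

Lemma rf_numden n (f : ratfct n) :
  f * rf_poly \d_(repr f) = rf_poly \n_(repr f).
Proof.
rewrite -{1}[f]reprK; move: (repr f) => r {f}.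
rewrite /rf_poly; unlock FracField.tofrac.
rewrite -[LHS](@FracField.pi_mul {mpoly k[n.+1]}); apply/eqmodP.
rewrite /= FracField.equivfE /FracField.mulf !numden_Ratio ?oner_eq0 //.
  by rewrite !mulr1 mulrC.
all: by rewrite mulr1 denom_ratioP.
Qed.

Lemma alg_indep_neq0 m n (v : 'I_m.+1 -> ratfct n) p :
  alg_indep v -> p != 0 -> mmap (@rf_const n) v p != 0.
Proof. by move=> iv; apply: contraNneq => /iv ->. Qed.

Lemma rf_substE m n (v : 'I_m.+1 -> ratfct n) (f : ratfct m) p q :
  alg_indep v -> q != 0 -> f * rf_poly q = rf_poly p ->
  rf_subst v f = mmap (@rf_const n) v p / mmap (@rf_const n) v q.
Proof.
move=> iv q0 fqp; have d0 := denom_ratioP (repr f).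
apply/eqP; rewrite eqr_div ?alg_indep_neq0 // -!rmorphM; apply/eqP.
congr mmap; apply: rf_poly_inj; rewrite !rmorphM /= -rf_numden -fqp.
by rewrite mulrAC.
Qed.

Lemma rf_subst_rmorph m n (v : 'I_m.+1 -> ratfct n) : alg_indep v ->
  exists2 phi : {rmorphism ratfct m -> ratfct n}, phi =1 rf_subst v &
    forall p, phi (rf_poly p) = mmap (@rf_const n) v p.
Proof.
move=> iv.
have polyE p : rf_subst v (rf_poly p) = mmap (@rf_const n) v p.
  by rewrite (@rf_substE _ _ v _ p 1) ?oner_neq0 ?rmorph1 ?divr1 ?mulr1.
have d0 (f : ratfct m) : \d_(repr f) != 0 := denom_ratioP (repr f).
have md0 (f : ratfct m) : mmap (@rf_const n) v \d_(repr f) != 0.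
  exact: alg_indep_neq0.
have sB : zmod_morphism (rf_subst v).
  move=> f g; rewrite (@rf_substE _ _ v _
    (\n_(repr f) * \d_(repr g) - \n_(repr g) * \d_(repr f))
    (\d_(repr f) * \d_(repr g))) ?mulf_neq0 //; last first.
    by rewrite rmorphB !rmorphM /= -!rf_numden sub_cross.
  rewrite rmorphB !rmorphM div_sub ?md0 //.
have sM : monoid_morphism (rf_subst v).
  split; first by rewrite -(rmorph1 (@rf_poly m)) polyE rmorph1.
  move=> f g; rewrite (@rf_substE _ _ v _ (\n_(repr f) * \n_(repr g))
    (\d_(repr f) * \d_(repr g))) ?mulf_neq0 //; last first.
    by rewrite !rmorphM /= -!rf_numden mulrACA.
  rewrite !rmorphM -mulf_div //.
pose aM := GRing.isZmodMorphism.Build _ _ (rf_subst v) sB.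
pose mM := GRing.isMonoidMorphism.Build _ _ (rf_subst v) sM.
pose phi : {rmorphism ratfct m -> ratfct n} :=
  HB.pack (rf_subst v) aM mM.
by exists phi.
Qed.

Lemma eq_rf_subst m n (v w : 'I_m.+1 -> ratfct n) f :
  v =1 w -> rf_subst v f = rf_subst w f.
Proof.
by move=> vw; rewrite /rf_subst !(@mmap_ext _ _ _ (@rf_const n) (@rf_const n) v w).
Qed.

Section Independent.
Variables (m n : nat) (v : 'I_m.+1 -> ratfct n).
Hypothesis iv : alg_indep v.

Lemma rf_subst_poly p : rf_subst v (rf_poly p) = mmap (@rf_const n) v p.
Proof. by have [phi phiE phip] := rf_subst_rmorph iv; rewrite -phiE. Qed.

Lemma rf_subst_const c : rf_subst v (rf_const m c) = rf_const n c.
Proof. by rewrite rf_subst_poly mmapC. Qed.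

Lemma rf_subst_var j : rf_subst v (rf_var m j) = v (inord j).
Proof. by rewrite rf_subst_poly mmapX mmap1U. Qed.

Lemma rf_subst1 : rf_subst v 1 = 1.
Proof. by have [phi phiE _] := rf_subst_rmorph iv; rewrite -phiE rmorph1. Qed.

Lemma rf_substM f g : rf_subst v (f * g) = rf_subst v f * rf_subst v g.
Proof. by have [phi phiE _] := rf_subst_rmorph iv; rewrite -!phiE rmorphM. Qed.

Lemma rf_subst_linear : linear (rf_subst v).
Proof.
move=> a f g; rewrite !rf_scaleE -rf_subst_const -rf_substM.
by have [phi phiE _] := rf_subst_rmorph iv; rewrite -!phiE rmorphD.
Qed.

Lemma rf_subst_fgl_iter theta u l :
  rf_subst v (fgl_iter (rf_const m theta) u l) =
  fgl_iter (rf_const n theta) (fun i => rf_subst v (u i)) l.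
Proof.
rewrite -(rf_subst_const theta).
have [phi phiE _] := rf_subst_rmorph iv; rewrite -!phiE rmorph_fgl_iter.
by apply: eq_fgl_iter => i _; rewrite /= phiE.
Qed.

Lemma rf_subst_comp l (w : 'I_l.+1 -> ratfct m) f :
  rf_subst v (rf_subst w f) = rf_subst (fun j => rf_subst v (w j)) f.
Proof.
have [phi phiE phip] := rf_subst_rmorph iv.
rewrite -phiE /rf_subst fmorph_div !rmorph_mmap.
by congr (_ / _); apply: mmap_ext => [c|j] /=; rewrite phiE ?rf_subst_const.
Qed.

End Independent.

Lemma alg_indep_retract m n (w : 'I_m.+1 -> {mpoly k[n.+1]})
    (r : 'I_n.+1 -> {mpoly k[m.+1]}) :
  (forall j, mmap (@mpolyC m.+1 k) r (w j) = 'X_j) ->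
  alg_indep (fun j => rf_poly (w j)).
Proof.
move=> wr p p0.
have wp0 : mmap (@mpolyC n.+1 k) w p = 0.
  apply: rf_poly_inj; rewrite rmorph_mmap rmorph0 -p0.
  exact: mmap_ext.
have := congr1 (mmap (@mpolyC m.+1 k) r) wp0.
rewrite rmorph_mmap rmorph0 => <-; rewrite -{1}[p]mmap_polyX.
by apply: mmap_ext => [c|j] /=; rewrite ?mmapC ?wr.
Qed.

Lemma alg_indep_var m n (s : 'I_m.+1 -> nat) :
  (forall j, s j < n.+1)%N -> injective s -> alg_indep (fun j => rf_var n (s j)).
Proof.
move=> sn s_inj; pose r (q : 'I_n.+1) : {mpoly k[m.+1]} :=
  \sum_(j | s j == q) 'X_j.
apply: (@alg_indep_retract _ _ (fun j => 'X_(inord (s j))) r) => j.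
rewrite mmapX mmap1U /r inordK // (big_pred1 j) // => j'.
by apply/eqP/eqP => [/s_inj|->].
Qed.

Lemma alg_indep_var_id n : alg_indep (fun j : 'I_n.+1 => rf_var n j).
Proof. by apply: alg_indep_var => // i j; apply: val_inj. Qed.

Lemma rf_subst_id n (f : ratfct n) : rf_subst (fun j => rf_var n j) f = f.
Proof.
have iv := @alg_indep_var_id n.
rewrite (rf_substE iv (denom_ratioP (repr f)) (rf_numden f)).
have vE p : mmap (@rf_const n) (fun j : 'I_n.+1 => rf_var n j) p = rf_poly p.
  rewrite -[in RHS](mmap_polyX p) rmorph_mmap; apply: mmap_ext => // j.
  by rewrite /rf_var inord_val.
rewrite !vE -rf_numden mulfK // rf_poly_eq0 denom_ratioP //.
Qed.

Lemma rf_cast m n (e : m = n) (f : ratfct m) :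
  ecast l (ratfct l) e f = rf_subst (fun j => rf_var n j) f.
Proof. by case: n / e => /=; rewrite rf_subst_id. Qed.

Definition rf_id : ratfct 0 := 1.

(* f(x_(s 0), ..., x_(s n)) *)
Definition rf_act n (s : 'S_n.+1) (f : ratfct n) : ratfct n :=
  rf_subst (fun j => rf_var n (s j)) f.

Lemma alg_indep_act n (s : 'S_n.+1) : alg_indep (fun j => rf_var n (s j)).
Proof. by apply: alg_indep_var => // i j /val_inj/perm_inj. Qed.
Arguments alg_indep_act {n} s.

Variable theta : k.

(* f(x_0, ..., F_(n+1)(x_i, ..., x_(i+n)), ..., x_(m+n)) * g(x_i, ..., x_(i+n)) *)
Definition rf_comp m n (i : 'I_m.+1) (f : ratfct m) (g : ratfct n) :
    ratfct (m + n) :=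
  rf_subst (fun j : 'I_m.+1 =>
      if j == i then fgl_iter (rf_const (m + n) theta)
                       (fun l => rf_var (m + n) (i + l)) n
      else rf_var (m + n) (outer n i j)) f
  * rf_subst (fun l : 'I_n.+1 => rf_var (m + n) (i + l)) g.

Definition rf_block N n (i j : nat) : ratfct N :=
  if j == i then fgl_iter (rf_const N theta) (fun l => rf_var N (i + l)) n
  else rf_var N (outer n i j).

Lemma rf_compE m n (i : 'I_m.+1) f g : @rf_comp m n i f g =
  rf_subst (fun j : 'I_m.+1 => rf_block (m + n) n i j) f
  * rf_subst (fun l : 'I_n.+1 => rf_var (m + n) (i + l)) g.
Proof. by []. Qed.

Lemma alg_indep_inner N m n (i : 'I_m.+1) : N = (m + n)%N ->
  alg_indep (fun l : 'I_n.+1 => rf_var N (i + l)).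
Proof.
move=> ->; apply: alg_indep_var => [j|j j' /addnI/val_inj //].
by have := ltn_ord i; have := ltn_ord j; lia.
Qed.

Lemma alg_indep_block N m n (i : 'I_m.+1) : N = (m + n)%N ->
  alg_indep (fun j : 'I_m.+1 => rf_block N n i j).
Proof.
move=> NE; have im := ltn_ord i.
pose w (j : 'I_m.+1) : {mpoly k[N.+1]} :=
  if (j : nat) == i then fgl_iter theta%:MP (fun l => 'X_(inord (i + l))) n
  else 'X_(inord (outer n i j)).
pose r (q : 'I_N.+1) : {mpoly k[m.+1]} :=
  if (q <= i)%N then 'X_(inord q)
  else if (q <= i + n)%N then 0 else 'X_(inord (q - n)).
have -> : (fun j : 'I_m.+1 => rf_block N n i j) = (fun j => rf_poly (w j)).
  apply/funext => j; rewrite /rf_block /w; case: eqP => // _.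
  by rewrite rmorph_fgl_iter.
apply: (@alg_indep_retract _ _ w r) => j; rewrite /w; case: eqP => [ji|ji].
  rewrite rmorph_fgl_iter /= mmapC.
  have -> : 'X_j = 'X_(inord i) :> {mpoly k[m.+1]}.
    by congr 'X_(_); apply: val_inj; rewrite /= inordK.
  elim: {-2}n (leqnn n) => [|l IHl] ln /=.
    by rewrite mmapX mmap1U /r addn0 inordK ?leqnn //; lia.
  rewrite IHl ?(ltnW ln) // mmapX mmap1U /r inordK; last by lia.
  have -> : (i + l.+1 <= i)%N = false by lia.
  have -> : (i + l.+1 <= i + n)%N by lia.
  by rewrite /fgl mulr0 !addr0.
have jm := ltn_ord j.
rewrite mmapX mmap1U /r /outer; case: (ltnP j i) => ij.
  by rewrite inordK; [rewrite ltnW // inord_val | lia].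
rewrite inordK; last by lia.
have -> : (j + n <= i)%N = false by lia.
have -> : (j + n <= i + n)%N = false by lia.
by rewrite addnK inord_val.
Qed.

Arguments alg_indep_inner {N m n} i NE.
Arguments alg_indep_block {N m n} i NE.

Lemma rf_subst_block N m n (i : 'I_m.+1) j : N = (m + n)%N -> (j < m.+1)%N ->
  rf_subst (fun j : 'I_m.+1 => rf_block N n i j) (rf_var m j) = rf_block N n i j.
Proof. by move=> NE jm; rewrite rf_subst_var ?inordK //; apply: alg_indep_block. Qed.

Lemma rf_subst_inner N m n (i : 'I_m.+1) j : N = (m + n)%N -> (j < n.+1)%N ->
  rf_subst (fun j : 'I_n.+1 => rf_var N (i + j)) (rf_var n j) = rf_var N (i + j).
Proof. by move=> NE jm; rewrite rf_subst_var ?inordK //; apply: alg_indep_inner. Qed.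

Lemma rf_act_linear n (s : 'S_n.+1) : linear (rf_act s).
Proof. by move=> a f g; rewrite /rf_act (rf_subst_linear (alg_indep_act s)). Qed.

Lemma rf_act1 n (f : ratfct n) : rf_act 1%g f = f.
Proof.
by rewrite -[RHS]rf_subst_id; apply: eq_rf_subst => j; rewrite perm1.
Qed.

Lemma rf_actM n (s t : 'S_n.+1) (f : ratfct n) :
  rf_act (s * t)%g f = rf_act t (rf_act s f).
Proof.
rewrite /rf_act (rf_subst_comp (alg_indep_act t)); apply: eq_rf_subst => j.
by rewrite (rf_subst_var (alg_indep_act t)) inord_val permM.
Qed.

Lemma rf_comp_linear_l m n (i : 'I_m.+1) (g : ratfct n) :
  linear (fun f : ratfct m => rf_comp i f g).
Proof.
move=> a f f'; rewrite !rf_compE.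
rewrite (rf_subst_linear (alg_indep_block i (erefl (m + n)%N))).
by rewrite mulrDl !rf_scaleE mulrA.
Qed.

Lemma rf_comp_linear_r m n (i : 'I_m.+1) (f : ratfct m) :
  linear (fun g : ratfct n => rf_comp i f g).
Proof.
move=> a g g'; rewrite !rf_compE.
rewrite (rf_subst_linear (alg_indep_inner i (erefl (m + n)%N))).
by rewrite mulrDr !rf_scaleE mulrCA.
Qed.

Lemma rf_comp_id_l n (f : ratfct n) : rf_comp ord0 rf_id f = f.
Proof.
rewrite rf_compE (rf_subst1 (@alg_indep_block n 0 n ord0 erefl)) mul1r.
exact: rf_subst_id.
Qed.

Lemma rf_comp_id_r n (i : 'I_n.+1) (f : ratfct n) :
  rf_comp i f rf_id = ecast l (ratfct l) (esym (addn0 n)) f.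
Proof.
rewrite rf_compE (rf_subst1 (alg_indep_inner i (erefl (n + 0)%N))) mulr1.
rewrite rf_cast; apply: eq_rf_subst => j; rewrite /rf_block /outer /=.
by case: eqP => [->|_]; rewrite ?addn0 ?if_same.
Qed.

Lemma rf_comp_seq m n p (i : 'I_m.+1) (j : 'I_n.+1)
    (f : ratfct m) (g : ratfct n) (h : ratfct p) :
  rf_comp (inord (i + j)) (rf_comp i f g) h =
  ecast l (ratfct l) (addnA m n p) (rf_comp i f (rf_comp j g h)).
Proof.
have im := ltn_ord i; have jn := ltn_ord j.
rewrite rf_cast !rf_compE.
set ij : 'I_(m + n).+1 := inord (i + j).
have ijE : ij = (i + j)%N :> nat by rewrite inordK //; lia.
have ib1 := alg_indep_block ij (erefl (m + n + p)%N).
have iid := @alg_indep_var_id (m + (n + p)).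
have NE : (m + n + p = m + (n + p))%N by lia.
have iX : alg_indep (fun l : 'I_(m + (n + p)).+1 => rf_var (m + n + p) l).
  by apply: alg_indep_var => [l|l l' /val_inj //]; have := ltn_ord l; lia.
have ii := alg_indep_inner i (erefl (m + (n + p))%N).
rewrite (rf_substM ib1) (rf_substM ii) 2!(rf_substM iX) 2!(rf_subst_comp ib1).
rewrite 2!(rf_subst_comp ii) 3!(rf_subst_comp iX) -mulrA.
have XE l : (l < (m + (n + p)).+1)%N ->
    rf_subst (fun l : 'I_(m + (n + p)).+1 => rf_var (m + n + p) l)
      (rf_var (m + (n + p)) l) = rf_var (m + n + p) l.
  by move=> lN; rewrite (rf_subst_var iX) inordK.
have blockE l : (l < (m + n).+1)%N ->
    rf_subst (fun l : 'I_(m + n).+1 => rf_block (m + n + p) p ij l)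
      (rf_var (m + n) l) = rf_block (m + n + p) p (i + j)%N l.
  by move=> lN; rewrite rf_subst_block // ijE.
congr (_ * (_ * _)); apply: eq_rf_subst => l; have ll := ltn_ord l.
- rewrite {2}/rf_block {2}/rf_block; case: eqP => li.
    rewrite (rf_subst_fgl_iter ib1) (rf_subst_fgl_iter iX).
    under [RHS]eq_fgl_iter => q qn do (rewrite XE; last by lia).
    rewrite -(fgl_iter_nest _ (fun q => rf_var (m + n + p) (i + q)) p (ltnSE jn)).
    apply: eq_fgl_iter => q qn; rewrite blockE; last by lia.
    rewrite /rf_block eqn_add2l; case: eqP => _.
      by apply: eq_fgl_iter => q' _; rewrite addnA.
    by congr rf_var; rewrite /outer ltn_add2l; do ?case: ifP; lia.
  rewrite blockE ?XE; [|rewrite /outer; case: ifP; lia..].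
  rewrite /rf_block; case: eqP => [|_]; first by rewrite /outer; case: ifP; lia.
  by congr rf_var; rewrite /outer; do !case: ifP; lia.
- rewrite blockE; last by lia.
  rewrite {2}/rf_block; case: eqP => lj.
    rewrite (rf_subst_fgl_iter ii) (rf_subst_fgl_iter iX).
    rewrite /rf_block eqn_add2l lj eqxx.
    apply: eq_fgl_iter => q qp.
    rewrite (rf_subst_inner i erefl) ?XE ?addnA //; lia.
  rewrite (rf_subst_inner i erefl) ?XE; [|rewrite /outer; case: ifP; lia..].
  rewrite /rf_block eqn_add2l; case: eqP => // _.
  by congr rf_var; rewrite /outer ltn_add2l; do ?case: ifP; lia.
- rewrite (rf_subst_inner i erefl) ?XE ?ijE ?addnA //; lia.
Qed.

Lemma rf_comp_par m n p (i j : 'I_m.+1)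
    (f : ratfct m) (g : ratfct n) (h : ratfct p) : (i < j)%N ->
  rf_comp (inord (outer n i j)) (rf_comp i f g) h =
  ecast l (ratfct l) (addnAC m p n)
    (rf_comp (inord (outer p j i)) (rf_comp j f h) g).
Proof.
move=> ij; have im := ltn_ord i; have jm := ltn_ord j.
rewrite rf_cast !rf_compE.
set j1 : 'I_(m + n).+1 := inord _; set i1 : 'I_(m + p).+1 := inord _.
have j1E : j1 = (j + n)%N :> nat.
  by rewrite /j1 /outer ltnNge (ltnW ij) /= inordK //; lia.
have i1E : i1 = i :> nat by rewrite /i1 /outer ij inordK //; lia.
set N := (m + n + p)%N; set N' := (m + p + n)%N.
have NE : N = N' by rewrite /N /N'; lia.
have ib1 := alg_indep_block j1 (erefl N).
have ib2 := alg_indep_block i1 (erefl N').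
have iX : alg_indep (fun l : 'I_N'.+1 => rf_var N l).
  by rewrite NE; apply: alg_indep_var_id.
rewrite (rf_substM iX) (rf_substM ib1) (rf_substM ib2) (rf_substM iX).
rewrite 2!(rf_subst_comp ib1) 2!(rf_subst_comp ib2) 3!(rf_subst_comp iX).
have XE l : (l < N'.+1)%N ->
    rf_subst (fun l : 'I_N'.+1 => rf_var N l) (rf_var N' l) = rf_var N l.
  by move=> lN; rewrite (rf_subst_var iX) inordK.
have b1E l : (l < (m + n).+1)%N ->
    rf_subst (fun l : 'I_(m + n).+1 => rf_block N p j1 l)
      (rf_var (m + n) l) = rf_block N p (j + n)%N l.
  by move=> lN; rewrite rf_subst_block // j1E.
have b2E l : (l < (m + p).+1)%N ->
    rf_subst (fun l : 'I_(m + p).+1 => rf_block N' n i1 l)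
      (rf_var (m + p) l) = rf_block N' n i l.
  by move=> lN; rewrite rf_subst_block // i1E.
rewrite [RHS]mulrAC.
congr (_ * _ * _); apply: eq_rf_subst => l; have ll := ltn_ord l.
- rewrite [rf_block (m + n) n i l]/rf_block [rf_block (m + p) p j l]/rf_block.
  have [->|li] := eqVneq (l : nat) i.
    have -> : ((i : nat) == j) = false by lia.
    rewrite /outer ij b2E; last by lia.
    rewrite /rf_block eqxx (rf_subst_fgl_iter ib1) (rf_subst_fgl_iter iX).
    apply: eq_fgl_iter => q qn; rewrite XE; last by lia.
    rewrite b1E; last by lia.
    rewrite /rf_block; case: eqP => [|_]; first by lia.
    by congr rf_var; rewrite /outer; do ?case: ifP; lia.
  have [->|lj] := eqVneq (l : nat) j.
    rewrite /outer ltnNge (ltnW ij) /= b1E; last by lia.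
    rewrite /rf_block eqxx 2!(rf_subst_fgl_iter ib2, rf_subst_fgl_iter iX).
    apply: eq_fgl_iter => q qn; rewrite b2E; last by lia.
    rewrite /rf_block; case: eqP => [|_]; first by lia.
    rewrite XE; last by rewrite /outer; case: ifP; lia.
    by congr rf_var; rewrite /outer; do ?case: ifP; lia.
  rewrite b1E ?b2E; [|rewrite /outer; case: ifP; lia..].
  rewrite /rf_block; case: eqP => [|_]; first by rewrite /outer; case: ifP; lia.
  case: eqP => [|_]; first by rewrite /outer; case: ifP; lia.
  rewrite XE; last by rewrite /outer; do !case: ifP; lia.
  by congr rf_var; rewrite /outer; do !case: ifP; lia.
- rewrite b1E ?XE; [|rewrite ?i1E; lia..].
  rewrite /rf_block; case: eqP => [|_]; first by lia.
  by congr rf_var; rewrite /outer i1E; do ?case: ifP; lia.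
- rewrite b2E; last by lia.
  rewrite /rf_block; case: eqP => [|_]; first by lia.
  rewrite XE; last by rewrite /outer; case: ifP; lia.
  by congr rf_var; rewrite j1E /outer; do ?case: ifP; lia.
Qed.

Lemma rf_comp_act m n (i : 'I_m.+1) (s : 'S_m.+1) (t : 'S_n.+1)
    (u : 'S_(m + n).+1) (f : ratfct m) (g : ratfct n) :
  is_block_perm i s t u ->
  rf_comp (s i) (rf_act s f) (rf_act t g) = rf_act u (rf_comp i f g).
Proof.
move=> [u_out u_in]; rewrite !rf_compE /rf_act.
have iu := alg_indep_act u.
have isb := alg_indep_block (s i) (erefl (m + n)%N).
have isi := alg_indep_inner (s i) (erefl (m + n)%N).
have uE j : (j < (m + n).+1)%N ->
    rf_subst (fun j => rf_var (m + n) (u j)) (rf_var (m + n) j) =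
    rf_var (m + n) (u (inord j)).
  by move=> jm; rewrite (rf_subst_var iu).
rewrite (rf_substM iu) (rf_subst_comp isb) (rf_subst_comp isi).
rewrite 2!(rf_subst_comp iu).
have im := ltn_ord i.
congr (_ * _); apply: eq_rf_subst => j; have jm := ltn_ord j.
- rewrite rf_subst_block ?ltn_ord // [in RHS]/rf_block.
  have [/val_inj->|ji] := eqVneq (j : nat) i.
    rewrite /rf_block eqxx (rf_subst_fgl_iter iu).
    rewrite -(fgl_iter_perm _ _ t); apply: eq_fgl_iter => l ln.
    rewrite uE; last by lia.
    by congr rf_var; rewrite -(inordK (m := l) ln) u_in inord_val.
  rewrite uE; last by rewrite /outer; case: ifP; lia.
  rewrite u_out // /rf_block; case: eqP => // /val_inj/perm_inj ji'.
  by rewrite ji' eqxx in ji.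
- rewrite rf_subst_inner ?ltn_ord // uE ?u_in //; lia.
Qed.

Definition RatFct : operad k :=
  @Operad k (fun n => ratfct n : lmodType k) rf_id rf_act rf_comp
    rf_act_linear rf_act1 rf_actM rf_comp_linear_l rf_comp_linear_r
    rf_comp_id_l rf_comp_id_r rf_comp_seq rf_comp_par rf_comp_act.

Definition RatFct_mu : RatFct 1 := 1 : ratfct 1.
Definition RatFct_R : RatFct 0 := (rf_var 0 0)^-1.

End RatFct.

(* Main.v *)
From HB Require Import structures.
Require Import Defs.
From mathcomp Require Import all_boot all_order all_algebra all_fingroup.
From mathcomp Require Import zify ring boolp mpoly.

Import GRing.Theory.
Local Open Scope ring_scope.

Set Implicit Arguments.
Unset Strict Implicit.
Unset Printing Implicit Defensive.

(* Rewriting products R(u) R(v) by the Rota-Baxter identity shows that RB(n)  *)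
(* is spanned by the relabellings of the words                                *)
(*   R^(a 0) (x_0 R^(a 1) (x_1 ... R^(a n) (x_n))).                           *)
(* By commutativity, a relabelled word only depends on the multichain of      *)
(* subsets T = {s j, ..., s n}, each taken a j times, and its image in        *)
(* RatFct is the product of the inverses 1 / F(T), where F(T) is the iterated *)
(* formal group law in the variables of T.  These products are linearly       *)
(* independent for distinct multichains: given a relation, let S be minimal   *)
(* among the sets that occur, multiply by the largest power of F(S) that      *)
(* occurs, and put x_i = 0 for i in S.  This kills F(S), turns F(T) into      *)
(* F(T \ S), and leaves a relation between multichains in the complement      *)
(* of S.                                                                      *)

(** The Rota-Baxter relation holds in [RatFct] because, once denominators are cleared, it is the
    formula for F ([rota_baxter_fgl]). The universal property then gives a morphism from [RB] onto
    the generated suboperad, and the substance is its injectivity. An upper and a lower bound meet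
    on the set of multichains. In [RB] the monomials span ([RB_span], [rb_span_monom_comb]), and
    each depends only on its multichain ([monom_multichain]). In [RatFct] distinct multichains give
    linearly independent functions ([rf_monom], [fgl_set_indep]). Hence a combination of monomials
    that vanishes in [RatFct] already vanishes in [RB] ([monom_sum_eq0]). *)

Section CastFreeEquality.
Variables (k : fieldType) (P : operad k).

(** The operad axioms relate operations whose arities agree only propositionally. With the cast
    hidden in an existential they chain by transitivity; [heqE] returns to plain equality. *)
Definition heq m n (x : P m) (y : P n) : Prop :=
  exists e : m = n, ecast l (P l) e x = y.

Lemma heq_refl n (x : P n) : heq x x.
Proof. by exists erefl. Qed.

Lemma heq_sym m n (x : P m) (y : P n) : heq x y -> heq y x.
Proof. by case=> e; case: n / e y => y <-; exists erefl. Qed.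

Lemma heq_trans m n p (x : P m) (y : P n) (z : P p) :
  heq x y -> heq y z -> heq x z.
Proof.
by case=> e; case: n / e y => y <- [e']; case: p / e' z => z <-; exists erefl.
Qed.

Lemma heqE n (x y : P n) : heq x y -> x = y.
Proof. by case=> e <-; rewrite (eq_irrelevance e erefl). Qed.

Lemma heq_cast m n (e : m = n) (x : P m) : heq (ecast l (P l) e x) x.
Proof. by apply: heq_sym; exists e. Qed.

Lemma heq_comp m m' n n' (i : 'I_m.+1) (i' : 'I_m'.+1) (x : P m) (x' : P m')
    (y : P n) (y' : P n') :
  i = i' :> nat -> heq x x' -> heq y y' -> heq (op_comp i x y) (op_comp i' x' y').
Proof.
move=> ii [e]; case: m' / e i' x' ii => i' x' /val_inj <- <- [e].
by case: n' / e y' => y' <-; exists erefl.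
Qed.

Lemma heq_comp_id_r n (i : 'I_n.+1) (x : P n) : heq (op_comp i x (op_id P)) x.
Proof. by rewrite op_comp_id_r; apply: heq_cast. Qed.

Lemma heq_comp_seq m n p (i : 'I_m.+1) (j : 'I_n.+1) (q : 'I_(m + n).+1)
    (x : P m) (y : P n) (z : P p) : q = (i + j)%N :> nat ->
  heq (op_comp q (op_comp i x y) z) (op_comp i x (op_comp j y z)).
Proof.
by move=> qE; rewrite -(inord_val q) qE op_comp_seq; apply: heq_cast.
Qed.

Lemma heq_comp_par m n p (i j : 'I_m.+1) (q : 'I_(m + n).+1)
    (i' : 'I_(m + p).+1) (x : P m) (y : P n) (z : P p) :
  (i < j)%N -> q = (j + n)%N :> nat -> i' = i :> nat ->
  heq (op_comp q (op_comp i x y) z) (op_comp i' (op_comp j x z) y).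
Proof.
move=> ij qE iE; rewrite -(inord_val q) qE -(inord_val i') iE.
have := op_comp_par x y z ij; rewrite /outer ij ltnNge (ltnW ij) /= => ->.
exact: heq_cast.
Qed.

Lemma act_comp_l m n (i : 'I_m.+1) (s : 'S_m.+1) (x : P m) (y : P n) :
  exists u, op_comp (s i) (op_act s x) y = op_act u (op_comp i x y).
Proof.
have [u uP] := is_block_perm_exists i s (1%g : 'S_n.+1); exists u.
by rewrite -(op_comp_act _ _ uP) op_act1.
Qed.

Lemma act_comp_r m n (i : 'I_m.+1) (t : 'S_n.+1) (x : P m) (y : P n) :
  exists u, op_comp i x (op_act t y) = op_act u (op_comp i x y).
Proof.
have [u uP] := is_block_perm_exists i (1%g : 'S_m.+1) t; exists u.
by rewrite -(op_comp_act _ _ uP) op_act1 perm1.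
Qed.

Lemma op_comp0l m n (i : 'I_m.+1) (y : P n) : op_comp i (0 : P m) y = 0.
Proof.
have := op_comp_linear_l i y (-1) 0 0.
by rewrite /= scaler0 addr0 scaleN1r addNr.
Qed.

Lemma op_comp0r m n (i : 'I_m.+1) (x : P m) : op_comp i x (0 : P n) = 0.
Proof.
have := op_comp_linear_r i x (-1) (0 : P n) 0.
by rewrite /= scaler0 addr0 scaleN1r addNr.
Qed.

Lemma op_compDl m n (i : 'I_m.+1) (x x' : P m) (y : P n) :
  op_comp i (x + x') y = op_comp i x y + op_comp i x' y.
Proof. by have := op_comp_linear_l i y 1 x x'; rewrite /= !scale1r. Qed.

Lemma op_compZl m n (i : 'I_m.+1) a (x : P m) (y : P n) :
  op_comp i (a *: x) y = a *: op_comp i x y.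
Proof. by have := op_comp_linear_l i y a x 0; rewrite /= op_comp0l !addr0. Qed.

End CastFreeEquality.

(** * A spanning set closed under composition *)

Section RotaBaxterSpan.
Variables (k : fieldType) (theta : k) (P : operad k) (mu : P 1) (R : P 0).
Hypothesis rbP : is_rota_baxter theta mu R.

Let muC : op_act (tperm ord0 ord_max) mu = mu. Proof. by case: rbP. Qed.
Let muA : op_comp ord0 mu mu = op_comp ord_max mu mu. Proof. by case: rbP. Qed.

(** Giving the first arity as 0, or as 1 in [mul_var], makes the arity of the composite compute, so
    that no cast appears. *)
Definition ap_R n (x : P n) : P n := @op_comp k P 0 n ord0 R x.

Definition mul_var n (x : P n) : P n.+1 := @op_comp k P 1 n ord_max mu x.

Definition mul_op m n (x : P m) (y : P n) : P (n + m).+1 :=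
  @op_comp k P n.+1 m ord0 (mul_var y) x.

(* By the Rota-Baxter identity, this is closed under all composites, although *)
(* only products by a variable are listed.                                    *)
Inductive rb_span : forall n, P n -> Prop :=
| rb_span0 n : rb_span (0 : P n)
| rb_span_lin n a (x y : P n) : rb_span x -> rb_span y -> rb_span (a *: x + y)
| rb_span_id : rb_span (op_id P)
| rb_span_act n (s : 'S_n.+1) (x : P n) : rb_span x -> rb_span (op_act s x)
| rb_span_R n (x : P n) : rb_span x -> rb_span (ap_R x)
| rb_span_mul_var n (x : P n) : rb_span x -> rb_span (mul_var x).

Lemma rb_span_heq m n (x : P m) (y : P n) : heq x y -> rb_span x -> rb_span y.
Proof. by case=> e; case: n / e y => y <-. Qed.

Lemma rb_spanD n (x y : P n) : rb_span x -> rb_span y -> rb_span (x + y).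
Proof. by move=> hx hy; rewrite -[x]scale1r; apply: rb_span_lin. Qed.

Lemma rb_spanZ n a (x : P n) : rb_span x -> rb_span (a *: x).
Proof.
move=> hx; rewrite -[_ *: _]addr0; apply: rb_span_lin => //; exact: rb_span0.
Qed.

Lemma mul_op_act_l m n s (x : P m) (y : P n) :
  rb_span (mul_op x y) -> rb_span (mul_op (op_act s x) y).
Proof.
move=> h; rewrite /mul_op; have [u ->] := act_comp_r ord0 s (mul_var y) x.
exact: rb_span_act.
Qed.

(** Since [mu] is symmetric, the two products differ by a block permutation of the inputs, under
    which the span is stable. *)
Lemma mul_opC m n (x : P m) (y : P n) :
  rb_span (mul_op x y) -> rb_span (mul_op y x).
Proof.
move=> h; rewrite /mul_op /mul_var.
have [u [u_out u_in]] :=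
  is_block_perm_exists ord0 (tperm ord0 (ord_max : 'I_2)) (1%g : 'S_m.+1).
have := op_comp_act mu x (conj u_out u_in); rewrite muC op_act1 tpermL => ->.
(* After [x] is grafted at input 0, the free input of [mu] has label m+1; [u] moves it to 0. *)
have -> : ord0 = u (inord m.+1) :> 'I_(1 + m).+1.
  apply: val_inj; have /= := u_out ord_max isT.
  rewrite tpermL tpermR /outer /= => e; apply: (etrans (esym e)).
  by congr (nat_of_ord (u _)).
have [v ->] := act_comp_l (inord m.+1) u (op_comp ord0 mu x) y.
apply: rb_span_act; move: h; apply: rb_span_heq; apply: heq_sym.
by apply: (@heq_comp_par k P 1 m n ord0 ord_max); rewrite ?inordK.
Qed.

Lemma mul_op_lin_l m n a (x x' : P m) (y : P n) :
  mul_op (a *: x + x') y = a *: mul_op x y + mul_op x' y.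
Proof. exact: (op_comp_linear_r (ord0 : 'I_n.+2) (mul_var y) a x x'). Qed.

(** Associativity of [mu]: (x_0 x) y = x_0 (x y). *)
Lemma mul_op_var m n (x : P m) (y : P n) :
  heq (mul_op (mul_var x) y) (mul_var (mul_op x y)).
Proof.
pose two : 'I_3 := inord 2.
have twoE : two = 2 :> nat by rewrite /two inordK.
have yE : heq (@op_comp k P n.+1 1 ord0 (mul_var y) mu) (mul_var (mul_var y)).
  apply: (@heq_trans _ _ _ _ _ _ (@op_comp k P 2 n two (op_comp ord0 mu mu) y)).
    by apply: heq_sym; apply: (@heq_comp_par k P 1 1 n ord0 ord_max).
  by rewrite muA; apply: (@heq_comp_seq k P 1 1 n ord_max ord_max).
pose one : 'I_n.+3 := inord 1; pose one' : 'I_(n.+1 + 1).+1 := inord 1.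
apply: (@heq_trans _ _ _ _ _ _ (@op_comp k P (n.+1 + 1) m one'
  (@op_comp k P n.+1 1 ord0 (mul_var y) mu) x)).
  apply: heq_sym; apply: (@heq_comp_seq k P n.+1 1 m ord0 ord_max).
  by rewrite /one' inordK // addn1.
apply: (@heq_trans _ _ _ _ _ _ (@op_comp k P n.+2 m one (mul_var (mul_var y)) x)).
  apply: heq_comp => //; last exact: heq_refl.
  by rewrite /one /one' !inordK // addn1.
apply: (@heq_comp_seq k P 1 n.+1 m ord_max ord0).
by rewrite /one inordK.
Qed.

Lemma mul_op_RR m n (x : P m) (y : P n) :
  mul_op (ap_R x) (ap_R y) =
  ap_R (mul_op (ap_R x) y) + ap_R (mul_op x (ap_R y)) + theta *: ap_R (mul_op x y).
Proof.
have rb : op_comp ord0 (op_comp ord_max mu R) R =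
    ap_R (op_comp ord0 mu R) + ap_R (op_comp ord_max mu R) + theta *: ap_R mu.
  by case: rbP.
(* Substitution of [x] and [y] into the two inputs of a binary [z] is linear and commutes with an
   outer [R], so it transports the binary identity. *)
pose sub2 (z : P 1) : P (n + m).+1 :=
  @op_comp k P n.+1 m ord0 (@op_comp k P 1 n ord_max z y) x.
have sub2D z z' : sub2 (z + z') = sub2 z + sub2 z'.
  by rewrite /sub2 2!op_compDl.
have sub2Z a z : sub2 (a *: z) = a *: sub2 z by rewrite /sub2 2!op_compZl.
have sub2R z : sub2 (ap_R z) = ap_R (sub2 z).
  rewrite /sub2.
  apply: heqE; apply: (@heq_trans _ _ _ _ _ _
    (@op_comp k P n.+1 m ord0 (ap_R (@op_comp k P 1 n ord_max z y)) x)).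
    apply: (@heq_comp k P n.+1 n.+1) => //; last exact: heq_refl.
    exact: (@heq_comp_seq k P 0 1 n ord0 ord_max).
  exact: (@heq_comp_seq k P 0 n.+1 m ord0 ord0).
have yR : mul_var (ap_R y) = @op_comp k P 1 n ord_max (op_comp ord_max mu R) y.
  by apply: heqE; apply: heq_sym; apply: (@heq_comp_seq k P 1 0 n ord_max ord0).
have mulRR : heq (mul_op (ap_R x) (ap_R y))
    (sub2 (op_comp ord0 (op_comp ord_max mu R : P 1) R)).
  rewrite /mul_op yR; apply: (@heq_trans _ _ _ _ _ _ (@op_comp k P (n.+1 + 0) m
    ord0 (@op_comp k P n.+1 0 ord0 (@op_comp k P 1 n ord_max
      (op_comp ord_max mu R) y) R) x)).
    by apply: heq_sym; apply: (@heq_comp_seq k P n.+1 0 m ord0 ord0).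
  apply: (@heq_comp k P (n.+1 + 0) n.+1) => //; last exact: heq_refl.
  apply: heq_sym; exact: (@heq_comp_par k P 1 0 n ord0 ord_max).
rewrite (heqE mulRR) rb 2!sub2D sub2Z !sub2R; congr (ap_R _ + ap_R _ + _).
  apply: heqE; apply: heq_sym; apply: (@heq_trans _ _ _ _ _ _
    (@op_comp k P (n.+1 + 0) m ord0 (@op_comp k P n.+1 0 ord0 (mul_var y) R) x)).
    by apply: heq_sym; apply: (@heq_comp_seq k P n.+1 0 m ord0 ord0).
  apply: (@heq_comp k P (n.+1 + 0) n.+1) => //; last exact: heq_refl.
  apply: heq_sym; exact: (@heq_comp_par k P 1 0 n ord0 ord_max).
by rewrite /mul_op yR.
Qed.

(** Double induction. The only hard case is R(x) R(y), where [mul_op_RR] leaves products in which at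
    least one factor has lost its R. When only [y] has a usable shape, [mul_opC] brings it to the
    left. *)
Lemma rb_span_mul_op m n (x : P m) (y : P n) :
  rb_span x -> rb_span y -> rb_span (mul_op x y).
Proof.
move=> hx; elim: hx n y => {m x}.
- by move=> m n y _; rewrite /mul_op op_comp0r; apply: rb_span0.
- move=> m a x x' _ hx _ hx' n y hy; rewrite mul_op_lin_l.
  by apply: rb_span_lin; [apply: hx | apply: hx'].
- move=> n y hy; apply: (rb_span_heq (heq_sym (heq_comp_id_r ord0 (mul_var y)))).
  exact: rb_span_mul_var.
- by move=> m s x _ hx n y hy; apply/mul_op_act_l/hx.
- move=> m x hx IHx n y hy; elim: hy => {n y}.
  + by move=> n; apply: mul_opC; rewrite /mul_op op_comp0r; apply: rb_span0.
  + move=> n a y y' _ hy _ hy'; apply: mul_opC; rewrite mul_op_lin_l.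
    by apply: rb_span_lin; apply: mul_opC.
  + apply: mul_opC.
    apply: (rb_span_heq (heq_sym (heq_comp_id_r ord0 (mul_var (ap_R x))))).
    exact/rb_span_mul_var/rb_span_R.
  + by move=> n s y _ hy; apply/mul_opC/mul_op_act_l/mul_opC.
  + move=> n y hy IHy; rewrite mul_op_RR; apply: rb_spanD.
      by apply: rb_spanD; apply: rb_span_R => //; apply/IHx/rb_span_R.
    exact/rb_spanZ/rb_span_R/IHx.
  + move=> n y _ hy; apply: mul_opC; apply: (rb_span_heq (heq_sym (mul_op_var _ _))).
    exact/rb_span_mul_var/mul_opC.
- move=> m x _ hx n y hy; apply: (rb_span_heq (heq_sym (mul_op_var _ _))).
  exact/rb_span_mul_var/hx.
Qed.

Lemma rb_span_comp m n (i : 'I_m.+1) (x : P m) (y : P n) :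
  rb_span x -> rb_span y -> rb_span (op_comp i x y).
Proof.
move=> hx hy; elim: hx i => {m x}.
- by move=> m i; rewrite op_comp0l; apply: rb_span0.
- move=> m a x x' _ hx _ hx' i; rewrite (op_comp_linear_l i y).
  by apply: rb_span_lin.
- by move=> i; rewrite (ord1 i) op_comp_id_l.
- move=> m s x _ hx i; rewrite -[i](permKV s).
  have [u ->] := act_comp_l (s^-1 i)%g s x y.
  exact/rb_span_act.
- move=> m x _ hx i; apply: (@rb_span_heq _ _ (ap_R (op_comp i x y))).
    by apply: heq_sym; apply: (@heq_comp_seq k P 0 m n ord0 i).
  exact: rb_span_R.
(* Grafting at input 0 of x_0 x gives a product with [y]; any other input is an input of [x]. *)
- move=> m x hx IHx i; case: (unliftP ord0 i) => [j|] ->; last first.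
    exact: rb_span_mul_op.
  apply: (@rb_span_heq _ _ (mul_var (op_comp j x y))).
    by apply: heq_sym; apply: (@heq_comp_seq k P 1 m n ord_max j).
  exact: rb_span_mul_var.
Qed.

Lemma rb_span_op : rb_span R.
Proof.
by apply: (rb_span_heq (heq_comp_id_r ord0 R)); apply/rb_span_R/rb_span_id.
Qed.

Lemma rb_span_mul : rb_span mu.
Proof.
by apply: (rb_span_heq (heq_comp_id_r ord_max mu)); apply/rb_span_mul_var/rb_span_id.
Qed.

End RotaBaxterSpan.

Lemma RB_span (k : fieldType) (theta : k) n (x : RB theta n) :
  rb_span (RB_mul theta) (RB_op theta) x.
Proof.
have rbP := RB_is_rota_baxter theta.
elim/pres_ind: x => x; elim: x => {n} [n []||||||].
- exact: rb_span_mul.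
- exact: rb_span_op.
- exact: rb_span_id.
- move=> n; exact: (@rb_span0 k (RB theta)).
- by move=> n x hx y hy; rewrite -piD; apply: (@rb_spanD k (RB theta)).
- by move=> n a x hx; rewrite -piZ; apply: (@rb_spanZ k (RB theta)).
- by move=> n s x hx; rewrite -pi_act; apply: (@rb_span_act k (RB theta)).
- move=> m n i x hx y hy; rewrite -pi_comp.
  exact: (@rb_span_comp k theta (RB theta)).
Qed.

Lemma val_tperm n (i j : nat) (z : 'I_n.+1) : (i <= n)%N -> (j <= n)%N ->
  tperm (inord i) (inord j) z =
    (if z == i :> nat then j else if z == j :> nat then i else z) :> nat.
Proof.
move=> ni nj; rewrite permE /= -!val_eqE /= !inordK //.
by case: ifP => _; [|case: ifP => _]; rewrite ?inordK.
Qed.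

(** * Words, and exchanging adjacent variables *)

Section Monomials.
Variables (k : fieldType) (theta : k) (P : operad k) (mu : P 1) (R : P 0).
Hypothesis rbP : is_rota_baxter theta mu R.

Lemma act_ap_R n (s : 'S_n.+1) (x : P n) :
  op_act s (ap_R R x) = ap_R R (op_act s x).
Proof.
rewrite /ap_R; have := @op_comp_act k P 0 n ord0 1%g s s R x.
rewrite perm1 op_act1 => -> //.
split=> [j|l]; first by rewrite (ord1 j) eqxx.
by rewrite perm1 inord_val.
Qed.

Lemma act_iter_ap_R n (s : 'S_n.+1) q (x : P n) :
  op_act s (iter q (ap_R R (n := n)) x) = iter q (ap_R R (n := n)) (op_act s x).
Proof. by elim: q => //= q IHq; rewrite act_ap_R IHq. Qed.

Lemma mul_var_act n (t : 'S_n.+1) (x : P n) :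
  mul_var mu (op_act t x) = op_act (lift_perm ord0 ord0 t) (mul_var mu x).
Proof.
rewrite /mul_var.
have := @op_comp_act k P 1 n ord_max 1%g t (lift_perm ord0 ord0 t) mu x.
rewrite perm1 op_act1 => -> //.
split=> [j jmax|l]; rewrite !perm1 /=.
  have -> : j = ord0 by apply: val_inj; case: j jmax => [[|[]]].
  have -> : inord (outer n 1 (ord0 : 'I_2)) = ord0 :> 'I_n.+2.
    by apply: val_inj; rewrite /= inordK.
  by rewrite lift_perm_id.
have -> : inord (1 + l) = lift ord0 l.
  by apply: val_inj; rewrite /= inordK // add1n ltnS.
by rewrite lift_perm_lift.
Qed.

(* R^(a 0) (x_0 R^(a 1) (x_1 ... R^(a n) (x_n))) *)
Fixpoint word n (a : nat -> nat) : P n :=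
  match n return P n with
  | 0%N => iter (a 0%N) (ap_R R (n := 0)) (op_id P)
  | n'.+1 => iter (a 0%N) (ap_R R (n := n'.+1))
               (mul_var mu (word n' (fun j => a j.+1)))
  end.

Lemma wordS n a : word n.+1 a =
  iter (a 0%N) (ap_R R (n := n.+1)) (mul_var mu (word n (fun j => a j.+1))).
Proof. by []. Qed.

Lemma ap_R_word n a :
  ap_R R (word n a) = word n (fun j => if j is 0 then (a 0%N).+1 else a j).
Proof. by case: n. Qed.

Lemma mul_var_word n a :
  mul_var mu (word n a) = word n.+1 (fun j => if j is j'.+1 then a j' else 0%N).
Proof. by []. Qed.

Lemma eq_word n a b : (forall j, (j <= n)%N -> a j = b j) -> word n a = word n b.
Proof.
elim: n a b => [|n IHn] a b ab /=; first by rewrite ab.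
by rewrite ab // (IHn _ (fun j => b j.+1)) // => j jn; rewrite ab.
Qed.

Lemma swap_mul_var_id :
  op_act (tperm (inord 0) (inord 1)) (mul_var mu (op_id P)) = mul_var mu (op_id P).
Proof.
have -> : mul_var mu (op_id P) = mu.
  by apply: heqE; apply: (@heq_comp_id_r k P 1 ord_max mu).
have [muC _ _] := rbP; rewrite -[RHS]muC; congr (op_act (tperm _ _) _).
  by apply: val_inj; rewrite /= inordK.
by apply: val_inj; rewrite /= inordK.
Qed.

(** Associativity rewrites x_0 (x_1 x) as (x_0 x_1) x, where commutativity of [mu] applies. *)
Lemma swap_mul_var2 n (x : P n) :
  op_act (tperm (inord 0) (inord 1)) (mul_var mu (mul_var mu x)) =
  mul_var mu (mul_var mu x).
Proof.
have [muC muA _] := rbP.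
pose nu : P 2 := op_comp ord_max mu mu.
pose s : 'S_3 := tperm (inord 0) (inord 1).
have sE (z : 'I_3) :
    s z = (if z == 0 :> nat then 1 else if z == 1 :> nat then 0 else z)%N :> nat.
  exact: val_tperm.
have nuC : op_act s nu = nu.
  have := @op_comp_act k P 1 1 ord0 1%g (tperm ord0 ord_max) s mu mu.
  rewrite perm1 op_act1 muC muA => <- //.
  split=> [j j0|l]; rewrite !perm1; apply: etrans (sE _) _.
    have -> : j = ord_max by apply: val_inj; case: j j0 => [[|[]]].
    by rewrite /outer /= inordK.
  by case: l => [[|[]]] // l2; rewrite inordK //= permE.
pose two : 'I_3 := inord 2.
have twoE : two = 2 :> nat by rewrite /two inordK.
have s2 : s two = two by apply: val_inj; rewrite /= sE twoE.
have xE : mul_var mu (mul_var mu x) = @op_comp k P 2 n two nu x.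
  apply/heqE/heq_sym.
  by apply: (@heq_comp_seq k P 1 1 n ord_max ord_max).
rewrite xE; have := @op_comp_act k P 2 n two s 1%g
  (tperm (inord 0) (inord 1)) nu x.
rewrite s2 nuC op_act1 => <- //; split=> [j j2|l].
  rewrite val_tperm // s2 /outer twoE.
  have jlt : (j < 2)%N.
    case: j j2 => [[|[|[]]]] //= j3; rewrite -val_eqE /= /two inordK //.
  have j3 : (j < n.+3)%N by lia.
  by rewrite sE jlt /= inordK //; case: (nat_of_ord j) jlt => [|[]].
have ln := ltn_ord l; rewrite val_tperm // s2 perm1 twoE inordK //.
Qed.

(** No R separates x_i from x_(i+1), so the two can be exchanged inside the word. *)
Lemma swap_word n i a : (i < n)%N -> a i.+1 = 0%N ->
  op_act (tperm (inord i) (inord i.+1)) (word n a) = word n a.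
Proof.
elim: n i a => [//|n IHn] [|i] a in_ ai0 /=; rewrite act_iter_ap_R; congr (iter _ _ _).
  case: n {IHn in_} => [|n] /=; rewrite ai0; first exact: swap_mul_var_id.
  exact: swap_mul_var2.
rewrite -[in RHS](IHn i) // mul_var_act; congr (op_act _ _).
apply/permP => z; apply: ord_inj; rewrite val_tperm ?ltnS //; last exact: ltnW.
case: (unliftP ord0 z) => [j|] ->; rewrite ?lift_perm_lift ?lift_perm_id //=.
rewrite /bump /= !add1n val_tperm //; last exact: ltnW.
by rewrite !eqSS; do !case: ifP.
Qed.

Definition monom n (a : nat -> nat) (s : 'S_n.+1) : P n := op_act s (word n a).

Definition monom_comb n (x : P n) : Prop :=
  exists r : seq (k * ((nat -> nat) * 'S_n.+1)),
    x = \sum_(p <- r) p.1 *: monom p.2.1 p.2.2.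

Lemma monom_comb_lin n c (x y : P n) :
  monom_comb x -> monom_comb y -> monom_comb (c *: x + y).
Proof.
move=> [r ->] [r' ->]; exists ([seq (c * p.1, p.2) | p <- r] ++ r').
rewrite big_cat big_map scaler_sumr /=; congr (_ + _).
by apply: eq_bigr => p _; rewrite scalerA.
Qed.

Lemma monom_comb_map n n' (f : P n -> P n') (x : P n) : linear f ->
  (forall a s, exists b t, f (monom a s) = monom b t) ->
  monom_comb x -> monom_comb (f x).
Proof.
move=> fL fM [r ->]; elim: r => [|p r IHr].
  exists [::]; rewrite !big_nil.
  by have := fL (-1) 0 0; rewrite scaler0 addr0 scaleN1r addNr.
rewrite big_cons fL; apply: monom_comb_lin => //.
have [b [t ->]] := fM p.2.1 p.2.2.
by exists [:: (1, (b, t))]; rewrite big_seq1 scale1r.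
Qed.

(** Relabelling, R and multiplication by a new variable each send a monomial to a single
    monomial. *)
Lemma rb_span_monom_comb n (x : P n) : rb_span mu R x -> monom_comb x.
Proof.
elim=> {n x}.
- by move=> n; exists [::]; rewrite big_nil.
- by move=> n c x y _ hx _ hy; apply: monom_comb_lin.
- by exists [:: (1, (fun=> 0%N, 1%g))]; rewrite big_seq1 scale1r /monom op_act1.
- move=> n s x _; apply: monom_comb_map; first exact: op_act_linear.
  by move=> a t; exists a, (t * s)%g; rewrite /monom op_actM.
- move=> n x _; apply: monom_comb_map; first exact: (op_comp_linear_r _ R).
  by move=> a s; rewrite -act_ap_R ap_R_word; do 2!eexists.
- move=> n x _; apply: monom_comb_map; first exact: (op_comp_linear_r _ mu).
  by move=> a s; rewrite mul_var_act mul_var_word; do 2!eexists.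
Qed.

End Monomials.

(** * Multichains *)

(** The inputs in the scope of R^(a j) in a word. *)
Definition tail n (j : nat) : {set 'I_n.+1} := [set i : 'I_n.+1 | (j <= i)%N].

Lemma card_tail n j : #|tail n j| = (n.+1 - j)%N.
Proof.
have := @big_nat_widenl _ 0%N addn j 0 n.+1 xpredT (fun=> 1%N) (leq0n j).
by rewrite sum_nat_const_nat muln1 big_mkord sum1dep_card -cardsE => ->.
Qed.

(* The multiplicity of T in the multichain of the sets s{j, ..., n}, each taken *)
(* a j times; j is determined by the cardinal of T. *)
Definition multichain n (a : nat -> nat) (s : 'S_n.+1) (T : {set 'I_n.+1}) : nat :=
  let j := (n.+1 - #|T|)%N in
  if (T != set0) && (T == s @: tail n j) then a j else 0%N.

Lemma tail_neq0 n j (s : 'S_n.+1) : (j <= n)%N -> s @: tail n j != set0.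
Proof.
by move=> jn; apply/set0Pn; exists (s ord_max); rewrite imset_f // inE.
Qed.

Lemma card_perm_tail n j (s : 'S_n.+1) : (j <= n)%N ->
  (n.+1 - #|s @: tail n j|)%N = j.
Proof.
by move=> jn; rewrite card_imset ?card_tail; [lia | exact: perm_inj].
Qed.

Lemma multichain_tail n a (s : 'S_n.+1) j : (j <= n)%N ->
  multichain a s (s @: tail n j) = a j.
Proof. by move=> jn; rewrite /multichain card_perm_tail // tail_neq0 // eqxx. Qed.

Lemma multichain_gt0 n a (s : 'S_n.+1) T : (0 < multichain a s T)%N ->
  exists2 j, (j <= n)%N & T = s @: tail n j.
Proof.
rewrite /multichain; case: ifP => // /andP[T0 /eqP TE] _.
exists (n.+1 - #|T|)%N => //; move: T0; rewrite -card_gt0; lia.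
Qed.

(** A multichain has at most one set of each cardinality, so comparing the two at both tails of size
    n+1-j suffices. *)
Lemma multichain_inj n a b (s t : 'S_n.+1) : multichain a s =1 multichain b t ->
  forall j, (j <= n)%N ->
    a j = b j /\ ((0 < a j)%N -> s @: tail n j = t @: tail n j).
Proof.
move=> ab j jn.
have := ab (s @: tail n j); have := ab (t @: tail n j).
rewrite !multichain_tail // /multichain !card_perm_tail // !tail_neq0 //=.
rewrite eq_sym; case: eqP => [-> <-|_ <- ->] //.
Qed.

(** * Sorted representatives of monomials *)

Section Sorting.
Variables (n : nat) (a : nat -> nat).

(** Variables not separated by an R may be permuted freely; the normal form lists their labels in
    increasing order. *)
Definition sorted_for (s : 'S_n.+1) : Prop :=
  forall i, (i < n)%N -> a i.+1 = 0%N -> (s (inord i) < s (inord i.+1))%N.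

(** If the inequality failed, the label of [s] at [m] would occur in [t] at a later position [l]. No
    R can stand between: its tail, common to [s] and [t], would contain position [l] of [t] but not
    position [m] of [s]. So [t] increases from [m] to [l], a contradiction. *)
Lemma sorted_for_leq (s t : 'S_n.+1) (m : nat) : sorted_for s -> sorted_for t ->
    (forall j, (j <= n)%N -> (0 < a j)%N -> s @: tail n j = t @: tail n j) ->
    (forall j, (j < m)%N -> s (inord j) = t (inord j)) -> (m <= n)%N ->
  (t (inord m) <= s (inord m))%N.
Proof.
move=> ss st stj stm mn; rewrite leqNgt; apply/negP => lt_m.
pose l := (t^-1 (s (inord m)))%g; have tl : t l = s (inord m) by rewrite permKV.
have lm : (m < l)%N.
  rewrite ltn_neqAle leqNgt; apply/andP; split; apply/negP.
    by move/eqP => lm; move: lt_m; rewrite -tl lm inord_val ltnn.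
  move=> lt_lm; have := stm _ lt_lm; rewrite inord_val tl => /perm_inj/(congr1 val).
  by rewrite /= inordK // => lE; rewrite lE ltnn in lt_lm.
have ln := ltn_ord l.
have a0 q : (m < q <= l)%N -> a q = 0%N.
  move=> /andP[mq ql]; apply/eqP; rewrite -leqn0 leqNgt; apply/negP => aq.
  have : s (inord m) \in s @: tail n q.
    by rewrite stj // -?tl ?imset_f ?inE //; lia.
  by rewrite mem_imset ?inE ?inordK //; [lia | exact: perm_inj].
have mono d : (m + d <= l)%N -> (t (inord m) <= t (inord (m + d)))%N.
  elim: d => [|d IHd] dl; first by rewrite addn0.
  apply: leq_trans (IHd _) _; first by lia.
  by rewrite addnS ltnW // st ?a0 //; lia.
have := mono (l - m)%N; rewrite subnKC ?(ltnW lm) // inord_val tl leqnn.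
by move=> /(_ isT); lia.
Qed.

Lemma sorted_for_inj (s t : 'S_n.+1) : sorted_for s -> sorted_for t ->
    (forall j, (j <= n)%N -> (0 < a j)%N -> s @: tail n j = t @: tail n j) ->
  s = t.
Proof.
move=> ss st stj; have sm m : (m <= n)%N -> s (inord m) = t (inord m).
  have [p] := ubnP m; elim: p m => // p IHp m mp mn.
  apply: ord_inj; apply/eqP; rewrite eqn_leq; apply/andP; split.
    apply: sorted_for_leq => // j; first by move=> jn aj; rewrite stj.
    by move=> jm; rewrite IHp //; lia.
  by apply: sorted_for_leq => // j jm; rewrite IHp //; lia.
by apply/permP => z; rewrite -(inord_val z) sm // -ltnS.
Qed.

(** The only tail separating i from i+1 is the one starting at i+1, and its multiplicity is 0. *)
Lemma multichain_swap (s : 'S_n.+1) i : (i < n)%N -> a i.+1 = 0%N ->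
  multichain a (tperm (inord i) (inord i.+1) * s)%g =1 multichain a s.
Proof.
move=> in_ ai T; rewrite /multichain; set j := (_ - _)%N.
have [->|ji] := eqVneq j i.+1; first by rewrite ai !if_same.
suff tj : tperm (inord i) (inord i.+1) @: tail n j = tail n j.
  by rewrite (eq_imset _ (permM _ _)) imset_comp tj.
apply/eqP; rewrite eqEcard card_imset ?leqnn ?andbT; last exact: perm_inj.
apply/subsetP => _ /imsetP[z zj ->]; move: zj.
rewrite !inE val_tperm //; last exact: ltnW.
by do ?case: eqP; lia.
Qed.

(** Rearrangement inequality: removing a descent raises this weight, which makes sorting
    terminate. *)
Lemma swap_sum_lt (s : 'S_n.+1) i : (i < n)%N ->
    (s (inord i.+1) < s (inord i))%N ->
  (\sum_(j < n.+1) j * s j <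
   \sum_(j < n.+1) j * (tperm (inord i) (inord i.+1) * s)%g j)%N.
Proof.
move=> in_ lt_s; set x : 'I_n.+1 := inord i; set y : 'I_n.+1 := inord i.+1.
have xE : x = i :> nat by rewrite /x inordK // ltnW.
have yE : y = i.+1 :> nat by rewrite /y inordK.
have yx : y != x by rewrite -val_eqE /= xE yE; lia.
rewrite (bigD1 x) //= [X in (_ < X)%N](bigD1 x) //=.
rewrite (bigD1 y) //= [X in (_ < _ + X)%N](bigD1 y) //=.
rewrite [X in (_ < _ + (_ + X))%N](eq_bigr (fun j : 'I_n.+1 => j * s j)%N).
  rewrite !permM tpermL tpermR xE yE; move: lt_s; rewrite -/x -/y.
  move: (\sum_(_ < _ | _) _)%N (nat_of_ord (s x)) (nat_of_ord (s y)) => S u v.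
  by move=> uv; rewrite !mulSn; lia.
by move=> j /andP[jx jy]; rewrite permM tpermD // eq_sym.
Qed.

End Sorting.

Section MonomUniqueness.
Variables (k : fieldType) (theta : k) (P : operad k) (mu : P 1) (R : P 0).
Hypothesis rbP : is_rota_baxter theta mu R.

Lemma monom_sorted n a (s : 'S_n.+1) : exists t : 'S_n.+1,
  [/\ monom mu R a t = monom mu R a s, multichain a t =1 multichain a s &
      sorted_for a t].
Proof.
(* Among the permutations with the same monomial and multichain, one of maximal weight has no
   removable descent. *)
pose Q (t : 'S_n.+1) :=
  `[< monom mu R a t = monom mu R a s /\ multichain a t =1 multichain a s >].
have Qs : Q s by apply/asboolP.
case: (arg_maxnP (fun t : 'S_n.+1 => \sum_(j < n.+1) j * t j)%N Qs).
move=> t /asboolP[tM tc] t_max; exists t; split=> // i in_ ai.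
rewrite ltnNge; apply/negP; rewrite leq_eqVlt => /orP[/eqP/ord_inj/perm_inj e|lt_t].
  by move/(congr1 val): e; rewrite /= !inordK //; lia.
have := swap_sum_lt in_ lt_t; rewrite ltnNge => /negP; apply; apply: t_max.
apply/asboolP; split; last by move=> T; rewrite multichain_swap.
by rewrite /monom op_actM (swap_word rbP).
Qed.

(** For sorted representatives, the multichain determines both the exponents and the permutation. *)
Lemma monom_multichain n a b (s t : 'S_n.+1) :
  multichain a s =1 multichain b t -> monom mu R a s = monom mu R b t.
Proof.
have [s' [<- s'c s'_sorted]] := monom_sorted a s.
have [t' [<- t'c t'_sorted]] := monom_sorted b t => st.
have st' : multichain a s' =1 multichain b t' by move=> T; rewrite s'c t'c.
have ab := multichain_inj st'.
have -> : s' = t'.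
  apply: (sorted_for_inj s'_sorted) => [i in_ ai|j jn]; last by case: (ab j jn).
  by apply: t'_sorted => //; have [<-] := ab i.+1 in_.
by rewrite /monom (@eq_word _ _ _ _ _ _ b) // => j /ab[].
Qed.

End MonomUniqueness.

(** * Linear independence of inverse products of F(T) *)

Section Independence.
Variables (k : fieldType) (theta : k) (N : nat).
Implicit Types S T U : {set 'I_N}.

(* F_n(x_(i_1), ..., x_(i_n)) for T = {i_1, ..., i_n} *)
Definition fgl_set T : {mpoly k[N]} := \big[fgl theta%:MP/0]_(i in T) 'X_i.

Definition kill S : {mpoly k[N]} -> {mpoly k[N]} :=
  mmap (@mpolyC N k) (fun i => if i \in S then 0 else 'X_i).
HB.instance Definition _ S := GRing.RMorphism.copy (kill S)
  (mmap (@mpolyC N k) (fun i : 'I_N => if i \in S then 0 else 'X_i)).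

Lemma kill_const S c : kill S c%:MP = c%:MP.
Proof. by rewrite /kill mmapC. Qed.

(** 0 is the unit of the formal group law, so killed variables drop out. *)
Lemma kill_fgl_set S T : kill S (fgl_set T) = fgl_set (T :\: S).
Proof.
rewrite /fgl_set (big_morph (kill S) (id1 := 0) (op1 := fgl theta%:MP)).
- rewrite [LHS]big_mkcond [RHS]big_mkcond; apply: eq_bigr => i _.
  by rewrite inE /kill mmapX mmap1U; case: (i \in S); rewrite ?if_same.
- by move=> p q; rewrite /fgl !rmorphD !rmorphM /= kill_const.
- exact: rmorph0.
Qed.

Lemma fgl_set0 : fgl_set set0 = 0.
Proof. by rewrite /fgl_set big_set0. Qed.

(** Killing all variables but one x_i with i in [T] leaves x_i. *)
Lemma fgl_set_neq0 T : T != set0 -> fgl_set T != 0.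
Proof.
case/set0Pn => i iT; apply: contraTneq isT => T0.
have := kill_fgl_set (~: [set i]) T.
have -> : T :\: ~: [set i] = [set i].
  by rewrite setDE setCK; apply/setIidPr; rewrite sub1set.
rewrite T0 rmorph0 /fgl_set big_set1 => /(congr1 (mcoeff U_(i))).
by rewrite mcoeffX eqxx mcoeff0 => /eqP; rewrite eq_sym oner_eq0.
Qed.

(** A multichain is encoded by its multiplicities, bounded by [M]: this makes the type finite, and
    F(T)^M clears every denominator. *)
Definition chain_on M U (c : {ffun {set 'I_N} -> 'I_M.+1}) : bool :=
  [forall T, (0 < c T)%N ==> (T != set0) && (T \subset U)] &&
  [forall T, forall T', (0 < c T)%N && (0 < c T')%N ==>
     (T \subset T') || (T' \subset T)].

Lemma chain_onP M U (c : {ffun {set 'I_N} -> 'I_M.+1}) :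
  reflect ((forall T, (0 < c T)%N -> T != set0 /\ T \subset U) /\
           forall T T', (0 < c T)%N -> (0 < c T')%N ->
             (T \subset T') || (T' \subset T)) (chain_on U c).
Proof.
apply: (iffP andP) => -[h1 h2]; split.
- by move=> T cT; have /implyP/(_ cT)/andP := forallP h1 T.
- move=> T T' cT cT'; have /forallP/(_ T')/implyP := forallP h2 T.
  by rewrite cT cT'; apply.
- by apply/forallP => T; apply/implyP => /h1[-> ->].
- by apply/forallP => T; apply/forallP => T'; apply/implyP => /andP[]; apply: h2.
Qed.

(* The multichain of the sets T :\: S, for the members T of c strictly above S. *)
Definition chain_restr M U S (c : {ffun {set 'I_N} -> 'I_M.+1}) :
    {ffun {set 'I_N} -> 'I_M.+1} :=
  [ffun T => if (T != set0) && (T \subset U :\: S) then c (T :|: S) else ord0].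

Lemma chain_restr_on M U S (c : {ffun {set 'I_N} -> 'I_M.+1}) :
  chain_on U c -> chain_on (U :\: S) (chain_restr U S c).
Proof.
case/chain_onP=> _ cc; apply/chain_onP; split=> [T|T T']; rewrite !ffunE.
  by case: ifP => // /andP[].
case: ifP => // /andP[_]; rewrite subsetD => /andP[_ dT].
case: ifP => // /andP[_]; rewrite subsetD => /andP[_ dT'].
have subU (X Y : {set 'I_N}) :
    [disjoint X & S] -> X :|: S \subset Y :|: S -> X \subset Y.
  by move=> dX; rewrite subUset (setUC Y) -subDset (setDidPl dX) => /andP[].
by move=> cT cT'; have /orP[/subU-> //|/subU->] := cc _ _ cT cT'; rewrite ?orbT.
Qed.

(** The hypothesis is a relation between the products of F(T)^(- c T), multiplied by the product of
    all F(T)^M. The proof is by induction on the size of [U], passing to [U :\: S] for a minimal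
    [S]. *)
Lemma fgl_set_indep M U (lam : {ffun {set 'I_N} -> 'I_M.+1} -> k) :
    \sum_(c | chain_on U c) (lam c)%:MP *
      \prod_(T : {set 'I_N} | (T != set0) && (T \subset U))
        fgl_set T ^+ (M - c T) = 0 ->
  forall c, chain_on U c -> lam c = 0.
Proof.
have [p] := ubnP #|U|; elim: p U lam => // p IHp U lam Up sum0 c1 c1U.
apply/eqP; apply/negPn/negP => c1_neq0.
pose good c := chain_on U c && (lam c != 0).
have good1 : good c1 by rewrite /good c1U.
have {}sum0 : \sum_(c | good c) (lam c)%:MP *
    \prod_(T : {set 'I_N} | (T != set0) && (T \subset U))
      fgl_set T ^+ (M - c T) = 0.
  rewrite -[RHS]sum0 [RHS](bigID (fun c => lam c != 0)) /=.
  rewrite [X in _ + X]big1 ?addr0 //.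
  by move=> c /andP[_ /negPn/eqP ->]; rewrite mpolyC0 mul0r.
have goodP c T : good c -> (0 < c T)%N -> T != set0 /\ T \subset U.
  by move=> /andP[/chain_onP[h _] _]; apply: h.
have prod_neq0 (Q : pred {set 'I_N}) (f : {set 'I_N} -> nat)
    (g : {set 'I_N} -> {set 'I_N}) :
    (forall T, Q T -> g T != set0) -> \prod_(T | Q T) fgl_set (g T) ^+ f T != 0.
  by move=> Qg; apply/prodf_neq0 => T /Qg gT; rewrite expf_neq0 ?fgl_set_neq0.
pose occurs S := [exists c, good c && (0 < c S)%N].
(* If no set occurs, the empty multichain is the only term, and its product is nonzero. *)
have [/existsP[S1 S1P]|none] := boolP [exists S, occurs S]; last first.
  have good0 c T : good c -> c T = 0%N :> nat.
    move=> gc; apply/eqP; rewrite -leqn0 leqNgt; apply: contra none => cT.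
    by apply/existsP; exists T; apply/existsP; exists c; rewrite gc.
  move: sum0; rewrite (big_pred1 c1) => [/eqP|c].
    rewrite mulf_eq0 mpolyC_eq0 (negPf c1_neq0) /=; apply/negP.
    by apply: (prod_neq0 _ _ id) => T /andP[].
  apply/idP/eqP => [gc|-> //].
  by apply/ffunP => T; apply: ord_inj; rewrite !good0.
case: (@arg_minnP _ _ occurs (fun S => #|S|) S1P) => S
  /existsP[c2 /andP[good2 c2S]] S_min {S1 S1P}.
case: (arg_maxnP (fun c : {ffun {set 'I_N} -> 'I_M.+1} => nat_of_ord (c S)) good2).
move=> c0 good0 max0; pose m : nat := c0 S.
have c0_max c : good c -> (c S <= m)%N by move=> gc; apply: max0.
have m_gt0 : (0 < m)%N by apply: leq_trans c2S (c0_max _ good2).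
have mM : (m <= M)%N by rewrite -ltnS ltn_ord.
have [S_neq0 SU] := goodP _ _ good0 m_gt0.
have below c T : good c -> T \subset S -> T != S -> c T = 0%N :> nat.
  move=> gc TS TnS; apply/eqP; rewrite -leqn0 leqNgt; apply/negP => cT.
  have : (#|S| <= #|T|)%N.
    by apply: S_min; apply/existsP; exists c; rewrite gc.
  by rewrite leqNgt => /negP; apply; apply: proper_card; rewrite properEneq TnS.
have side c T : good c -> c S = m :> nat -> ~~ (T \subset S) -> ~~ (S \subset T) ->
    c T = 0%N :> nat.
  move=> gc cS TS ST; apply/eqP; rewrite -leqn0 leqNgt; apply/negP => cT.
  have /andP[/chain_onP[_ /(_ T S cT) +] _] := gc.
  by rewrite cS m_gt0 (negPf TS) (negPf ST) => /(_ isT).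
(* Killing [S] annihilates F(T) for every T inside [S], so the part of these factors common to all
   terms is cancelled beforehand. *)
pose low : {mpoly k[N]} := fgl_set S ^+ (M - m) *
  \prod_(T : {set 'I_N} | (T != set0) && (T \subset U) && (T != S) && (T \subset S))
    fgl_set T ^+ M.
have low_neq0 : low != 0.
  rewrite mulf_neq0 ?expf_neq0 ?fgl_set_neq0 //.
  by apply: (prod_neq0 _ _ id) => T /andP[/andP[/andP[]]].
have {}sum0 : \sum_(c | good c) (lam c)%:MP * (fgl_set S ^+ (m - c S) *
    \prod_(T : {set 'I_N} | (T != set0) && (T \subset U) && ~~ (T \subset S))
      fgl_set T ^+ (M - c T)) = 0.
  apply/eqP; rewrite -(mulIr_eq0 _ (mulIf low_neq0)) -[X in _ == X]sum0 mulr_suml.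
  apply/eqP; apply: eq_bigr => c gc; rewrite -mulrA; congr (_ * _).
  rewrite [RHS](bigD1 S) ?S_neq0 //=.
  rewrite [X in _ = _ * X](bigID (fun T : {set 'I_N} => T \subset S)) /=.
  have -> : (M - c S = (m - c S) + (M - m))%N by rewrite addnC addnBA ?subnK ?c0_max.
  rewrite exprD /low -!mulrA; congr (_ * _); rewrite mulrC -!mulrA; congr (_ * _).
  congr (_ * _).
    apply: eq_bigr => T /andP[/andP[_ TnS] TS].
    by rewrite below // subn0.
  apply: eq_bigl => T; case: (T =P S) => [->|_]; rewrite ?andbT //.
  by rewrite subxx !andbF.
move/(congr1 (kill S)): sum0; rewrite rmorph0 rmorph_sum /= => sum0.
(* The sets incomparable with [S] have exponent M in every surviving term, since those terms contain
   [S]; they cancel as well. *)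
pose side_prod : {mpoly k[N]} := \prod_(T : {set 'I_N} | (T != set0) &&
  (T \subset U) && ~~ (T \subset S) && ~~ (S \subset T)) fgl_set (T :\: S) ^+ M.
have side_neq0 : side_prod != 0.
  by apply: prod_neq0 => T /andP[/andP[_ TS] _]; rewrite setD_eq0.
(* All other terms keep a positive power of F(S), which is now 0. *)
pose top c := good c && (c S == m :> nat).
have {}sum0 : \sum_(c | top c) (lam c)%:MP *
    \prod_(T : {set 'I_N} | (T != set0) && (T \subset U :\: S))
      fgl_set T ^+ (M - chain_restr U S c T) = 0.
  apply/eqP; rewrite -(mulIr_eq0 _ (mulIf side_neq0)) -[X in _ == X]sum0 mulr_suml.
  rewrite [X in _ == X](bigID
    (fun c : {ffun {set 'I_N} -> 'I_M.+1} => c S == m :> nat)) /=.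
  rewrite [X in _ + X]big1 ?addr0.
    apply/eqP; apply: eq_bigr => c /andP[gc /eqP cS].
    rewrite !rmorphM /= kill_const cS subnn -mulrA; congr (_ * _).
    rewrite expr0 rmorph1 mul1r rmorph_prod.
    rewrite [RHS](bigID (fun T : {set 'I_N} => S \subset T)) /=; congr (_ * _).
      (* Nonempty subsets of [U :\: S] correspond to the sets strictly between [S] and [U], with [U]
         included. *)
      rewrite [RHS](reindex_onto (fun T => T :|: S) (fun T => T :\: S)) /=; last first.
        move=> T /andP[_ /subsetP ST]; apply/setP => i; rewrite !inE.
        by have := ST i; case: (i \in S) => [/(_ isT) ->|_]; rewrite ?orbT ?orbF.
      have nzE T : (T != set0) && (T \subset U :\: S) =
          (T :|: S != set0) && (T :|: S \subset U) && ~~ (T :|: S \subset S) &&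
          (S \subset T :|: S) && ((T :|: S) :\: S == T).
        rewrite setU_eq0 (negPf S_neq0) andbF !subUset subxx SU subsetUr subsetD.
        rewrite setDUl setDv setU0 !andbT /= (sameP setDidPl eqP).
        case: (T :\: S =P T) => [e|_]; last by rewrite !andbF.
        by rewrite !andbT -(setD_eq0 T S) e andbC.
      apply: eq_big => [T|T Tnz]; first exact: nzE.
      rewrite rmorphXn /= kill_fgl_set ffunE Tnz; move: Tnz.
      by rewrite nzE => /andP[_ /eqP ->].
    apply: eq_bigr => T /andP[/andP[_ TS] ST].
    by rewrite rmorphXn /= kill_fgl_set side // subn0.
  move=> c /andP[gc cS]; rewrite !rmorphM rmorphXn /= kill_fgl_set setDv fgl_set0.
  rewrite expr0n; have -> : (m - c S == 0)%N = false.
    by apply/negbTE; rewrite subn_eq0 -ltnNge ltn_neqAle cS c0_max.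
  by rewrite mul0r mulr0.
pose lam' c' := \sum_(c | top c && (chain_restr U S c == c')) lam c.
have lam'0 : forall c', chain_on (U :\: S) c' -> lam' c' = 0.
  apply: IHp.
    have := subset_leq_card SU; move: S_neq0; rewrite -card_gt0.
    by rewrite cardsD (setIidPr SU); lia.
  rewrite -[RHS]sum0 [RHS](partition_big (chain_restr U S) (chain_on (U :\: S))) /=.
    apply: eq_bigr => c' _; rewrite /lam' rmorph_sum mulr_suml.
    by apply: eq_bigr => c /andP[_ /eqP ->].
  by move=> c /andP[/andP[cU _] _]; apply: chain_restr_on.
(* Restriction is injective on [top]: below and beside [S] multiplicities vanish, and at [S] they
   equal [m]. So the collected coefficient is that of [c0] alone. *)
have /andP[c0U /eqP] := good0; apply; rewrite -[RHS](lam'0 (chain_restr U S c0)).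
  rewrite /lam' (big_pred1 c0) // => c.
  apply/idP/eqP => [/andP[/andP[gc /eqP cS] /eqP cc]|->].
    apply/ffunP => T; apply: ord_inj.
    have [TS|TS] := boolP (T \subset S).
      by have [->|TnS] := eqVneq T S; [rewrite cS | rewrite !below].
    have [ST|ST] := boolP (S \subset T); last first.
      by rewrite (side _ _ gc cS TS ST) (side _ _ good0 _ TS ST).
    have [TU|TU] := boolP (T \subset U); last first.
      have zero c' : good c' -> c' T = 0%N :> nat.
        move=> gc'; apply/eqP; rewrite -leqn0 leqNgt; apply: contra TU.
        by move=> /(goodP _ _ gc')[].
      by rewrite !zero.
    have /ffunP/(_ (T :\: S)) := cc; rewrite !ffunE setD_eq0 TS setSD //=.
    suff -> : T :\: S :|: S = T by move=> ->.
    apply/setP => i; rewrite !inE; have := subsetP ST i.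
    by case: (i \in S) => [/(_ isT) ->|_]; rewrite ?orbT ?orbF.
  by rewrite /top good0 !eqxx.
exact: chain_restr_on.
Qed.

End Independence.

(** * Monomials as rational functions *)

Section RationalFunctions.
Variables (k : fieldType) (theta : k).
Let mu := RatFct_mu theta.
Let R := RatFct_R theta.

Definition rf_fgl n (T : {set 'I_n.+1}) : ratfct k n := rf_poly (fgl_set theta T).

Lemma rf_fgl_neq0 n (T : {set 'I_n.+1}) : T != set0 -> rf_fgl T != 0.
Proof. by move=> T0; rewrite rf_poly_eq0 fgl_set_neq0. Qed.

Lemma rmorph_fgl_set N (K : comNzRingType) (f : {rmorphism {mpoly k[N]} -> K}) T :
  f (fgl_set theta T) = \big[fgl (f theta%:MP)/0]_(i in T) f 'X_i.
Proof.
apply: (big_morph f) => [p q|]; last exact: rmorph0.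
by rewrite /fgl !rmorphD !rmorphM.
Qed.

Lemma rf_subst_fgl m n (s : 'I_m.+1 -> 'I_n.+1) (T : {set 'I_m.+1}) :
  injective s -> rf_subst (fun j => rf_var k n (s j)) (rf_fgl T) = rf_fgl (s @: T).
Proof.
move=> s_inj; have iv : alg_indep (fun j => rf_var k n (s j)).
  by apply: alg_indep_var => // i j /ord_inj/s_inj.
rewrite (rf_subst_poly iv) /rf_fgl 2!rmorph_fgl_set /= mmapC.
rewrite big_imset; last by move=> i j _ _; apply: s_inj.
by apply: eq_bigr => i _; rewrite mmapX mmap1U /rf_var inord_val.
Qed.

Lemma fgl_iter_var n :
  fgl_iter (rf_const n theta) (fun l => rf_var k n l) n = rf_fgl [set: 'I_n.+1].
Proof.
rewrite fgl_iterE big_mkord /rf_fgl rmorph_fgl_set.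
by apply: eq_big => [i|i _]; rewrite ?inE // /rf_var inord_val.
Qed.

Lemma rf_substV m n (v : 'I_m.+1 -> ratfct k n) (f : ratfct k m) :
  alg_indep v -> rf_subst v f^-1 = (rf_subst v f)^-1.
Proof. by move=> /rf_subst_rmorph[f' f'E _]; rewrite -!f'E fmorphV. Qed.

Lemma rf_ap_R n (f : ratfct k n) :
  ap_R (P := RatFct theta) R f = (rf_fgl [set: 'I_n.+1])^-1 * f.
Proof.
have iv := alg_indep_block (theta := theta) (i := ord0 : 'I_1) (erefl n).
rewrite /ap_R /= /R /RatFct_R (@rf_compE k theta 0 n ord0); congr (_ * _).
  by rewrite (rf_substV _ iv) (rf_subst_var iv) /rf_block inordK //= fgl_iter_var.
exact: rf_subst_id.
Qed.

Lemma rf_mul_var n (f : ratfct k n) :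
  mul_var (P := RatFct theta) mu f =
  rf_subst (fun j => rf_var k n.+1 (lift ord0 j)) f.
Proof.
rewrite /mul_var /= /mu /RatFct_mu (@rf_compE k theta 1 n ord_max).
by rewrite (rf_subst1 (alg_indep_block (i := ord_max : 'I_2) (erefl n.+1))) mul1r.
Qed.

(** Multiplied by x y F, this is F = y + x + t x y. *)
Lemma rota_baxter_fgl (K : fieldType) (t x y : K) :
    x != 0 -> y != 0 -> fgl t x y != 0 ->
  y^-1 * x^-1 = (fgl t x y)^-1 * x^-1 + (fgl t x y)^-1 * y^-1 + t * (fgl t x y)^-1.
Proof. by rewrite /fgl => x0 y0 f0; field; rewrite x0 y0 f0. Qed.

Lemma RatFct_rota_baxter : is_rota_baxter theta mu R.
Proof.
have comp_mu n (i : 'I_2) (f : ratfct k n) : @rf_comp k theta 1 n i 1 f =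
    rf_subst (fun l : 'I_n.+1 => rf_var k n.+1 (i + l)) f.
  by rewrite rf_compE (rf_subst1 (alg_indep_block (i := i) (erefl n.+1))) mul1r.
have inner N n (i : 'I_2) (NE : N = (1 + n)%N) :=
  alg_indep_inner (k := k) (i := i) NE.
have muR (i : 'I_2) : @rf_comp k theta 1 0 i 1 (rf_var k 0 0)^-1 = (rf_var k 1 i)^-1.
  rewrite comp_mu (rf_substV _ (inner 1%N 0%N i erefl)).
  by rewrite (@rf_subst_inner k 1 1 0 i _ erefl) // [(i + 0)%N]addn0.
split; rewrite /mu /R.
- by rewrite /= /RatFct_mu /rf_act (rf_subst1 (@alg_indep_act k 1 _)).
- rewrite /= /RatFct_mu !comp_mu.
  rewrite (rf_subst1 (inner 2%N 1%N ord0 erefl)).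
  by rewrite (rf_subst1 (inner 2%N 1%N ord_max erefl)).
rewrite -!/(ap_R _ _) !rf_ap_R /= /RatFct_mu /RatFct_R !muR.
have RR : @rf_comp k theta 1 0 ord0 (rf_var k 1 1)^-1 (rf_var k 0 0)^-1 =
    (rf_var k 1 1)^-1 * (rf_var k 1 0)^-1.
  have ib := alg_indep_block (theta := theta) (i := ord0 : 'I_2) (erefl (1 + 0)%N).
  rewrite rf_compE (rf_substV _ ib) (rf_substV _ (inner 1%N 0%N ord0 erefl)).
  rewrite (@rf_subst_block k theta 1 1 0 ord0 _ erefl) //.
  by rewrite (@rf_subst_inner k 1 1 0 ord0 _ erefl).
rewrite RR rf_scaleE mulr1 -fgl_iter_var /=.
have var_neq0 j : rf_var k 1 j != 0.
  rewrite rf_poly_eq0; apply/eqP => /(congr1 (mcoeff U_(inord j))).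
  by rewrite mcoeffX eqxx mcoeff0 => /eqP; rewrite oner_eq0.
apply: rota_baxter_fgl => //.
have := @rf_fgl_neq0 1 [set: 'I_2]; rewrite -fgl_iter_var; apply.
by apply/set0Pn; exists ord0.
Qed.

(** By [rf_ap_R], each R divides by F of the inputs in its scope, while [mul_var] only shifts the
    variables. *)
Lemma rf_word n (a : nat -> nat) : word mu R n a =
  (\prod_(j < n.+1) rf_fgl (tail n j) ^+ a j)^-1 :> ratfct k n.
Proof.
have iter_R m q (f : ratfct k m) : iter q (ap_R (P := RatFct theta) R (n := m)) f =
    (rf_fgl [set: 'I_m.+1] ^+ q)^-1 * f.
  elim: q => [|q IHq]; first by rewrite expr0 invr1 mul1r.
  by rewrite iterS IHq [LHS]rf_ap_R mulrA exprS invfM mulrC.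
have tail0 m : tail m 0 = [set: 'I_m.+1] by apply/setP => i; rewrite !inE.
elim: n a => [|n IHn] a; first by rewrite [LHS]iter_R big_ord1 tail0 mulr1.
rewrite wordS [LHS]iter_R rf_mul_var IHn [in RHS]big_ord_recl tail0 invfM.
congr (_ * _).
have iv : alg_indep (fun j : 'I_n.+1 => rf_var k n.+1 (lift ord0 j)).
  by apply: alg_indep_var => // i j /ord_inj/lift_inj.
rewrite (rf_substV _ iv); congr (_^-1).
have [f fE _] := rf_subst_rmorph iv; rewrite -fE rmorph_prod.
apply: eq_bigr => j _; rewrite rmorphXn fE rf_subst_fgl; last exact: lift_inj.
congr (rf_fgl _ ^+ _); apply/setP => z; apply/imsetP/idP => [[i]|].
  by rewrite !inE => ji ->; rewrite /= /bump /= !add1n ltnS.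
rewrite inE; case: (unliftP ord0 z) => [i|] -> //.
rewrite /= /bump /= !add1n ltnS => ji.
by exists i; rewrite ?inE.
Qed.

Lemma rf_monom n (a : nat -> nat) (s : 'S_n.+1) : monom mu R a s =
  (\prod_(T : {set 'I_n.+1} | T != set0) rf_fgl T ^+ multichain a s T)^-1
  :> ratfct k n.
Proof.
rewrite /monom rf_word /= /rf_act (rf_substV _ (@alg_indep_act k n s)); congr (_^-1).
have [f fE _] := rf_subst_rmorph (@alg_indep_act k n s); rewrite -fE rmorph_prod.
pose h (j : 'I_n.+1) := s @: tail n j.
have hK : cancel h (fun T => inord (n.+1 - #|T|)).
  by move=> j; rewrite /h card_perm_tail ?inord_val // -ltnS.
(* A set can only be the tail at position n+1-#|T|; sets that are not that tail contribute 1. *)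
rewrite [RHS](bigID (fun T : {set 'I_n.+1} => T == h (inord (n.+1 - #|T|)))) /=.
rewrite [X in _ * X]big1 ?mulr1; last first.
  move=> T /andP[T0]; rewrite /h inordK; last by rewrite ltn_subrL card_gt0 T0.
  by rewrite /multichain T0 => /negPf->.
rewrite (reindex_onto h
  (fun T : {set 'I_n.+1} => inord (n.+1 - #|T|))) /=; last first.
  by move=> T /andP[_ /eqP].
rewrite big_mkcond /=; apply: eq_big => [j|j _].
  by rewrite hK !eqxx /h tail_neq0 // -ltnS.
rewrite rmorphXn fE rf_subst_fgl; last exact: perm_inj.
by rewrite /h multichain_tail // -ltnS.
Qed.

Lemma multichain_chain n M (a : nat -> nat) (s : 'S_n.+1)
    (c : {ffun {set 'I_n.+1} -> 'I_M.+1}) :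
  (forall T, c T = multichain a s T :> nat) -> chain_on setT c.
Proof.
move=> cE; apply/chain_onP; split=> [T|T T']; rewrite !cE.
  by move=> /multichain_gt0[j jn ->]; rewrite tail_neq0 ?subsetT.
move=> /multichain_gt0[i _ ->] /multichain_gt0[j _ ->].
by case/orP: (leq_total i j) => ij; apply/orP; [right | left]; apply: imsetS;
  apply/subsetP => z; rewrite !inE; apply: leq_trans.
Qed.

(** Terms are grouped by multichain. Independence in [RatFct] kills the total coefficient of each
    group, and in [P] all monomials of a group coincide. *)
Lemma monom_sum_eq0 (P : operad k) (nu : P 1) (Q : P 0) n
    (r : seq (k * ((nat -> nat) * 'S_n.+1))) : is_rota_baxter theta nu Q ->
    \sum_(p <- r) p.1 *: (monom mu R p.2.1 p.2.2 : ratfct k n) = 0 ->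
  \sum_(p <- r) p.1 *: monom nu Q p.2.1 p.2.2 = 0.
Proof.
move=> rbP sum0.
have p0 : k * ((nat -> nat) * 'S_n.+1) by exact: (0, (fun=> 0%N, 1%g)).
rewrite (big_nth p0) big_mkord in sum0; rewrite (big_nth p0) big_mkord.
set e := nth p0 r in sum0 *.
have {}sum0 : \sum_(i < size r) (e i).1 *: (\prod_(T : {set 'I_n.+1} | T != set0)
    rf_fgl T ^+ multichain (e i).2.1 (e i).2.2 T)^-1 = 0.
  by rewrite -[RHS]sum0; apply: eq_bigr => i _; rewrite -rf_monom.
(* A common bound on the exponents, so that all multichains fit in one finite type. *)
pose M := (\max_(i < size r) \max_(j < n.+1) (e i).2.1 j)%N.
pose c (p : k * ((nat -> nat) * 'S_n.+1)) : {ffun {set 'I_n.+1} -> 'I_M.+1} :=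
  [ffun T => inord (multichain p.2.1 p.2.2 T)].
have cE (i : 'I_(size r)) T :
    c (e i) T = multichain (e i).2.1 (e i).2.2 T :> nat.
  rewrite ffunE inordK // ltnS /multichain.
  case: ifP => // /andP[T0 _]; have Tn : (n.+1 - #|T| < n.+1)%N.
    by rewrite ltn_subrL card_gt0 T0.
  apply: leq_trans (leq_bigmax i).
  exact: (leq_bigmax (F := fun j : 'I_n.+1 => (e i).2.1 j) (Ordinal Tn)).
pose lam (d : {ffun {set 'I_n.+1} -> 'I_M.+1}) : k :=
  \sum_(i < size r | c (e i) == d) (e i).1.
have c_chain (i : 'I_(size r)) : chain_on setT (c (e i)) := multichain_chain (cE i).
have lam0 : forall d, chain_on setT d -> lam d = 0.
  apply: (@fgl_set_indep _ theta); apply: (@rf_poly_inj _ n); rewrite rmorph0.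
  pose F : ratfct k n :=
    \prod_(T : {set 'I_n.+1} | (T != set0) && (T \subset setT)) rf_fgl T ^+ M.
  rewrite -[RHS](mulr0 F) -sum0 mulr_sumr rmorph_sum.
  rewrite [RHS](partition_big (fun i : 'I_(size r) => c (e i)) (chain_on setT)) //=.
  apply: eq_bigr => d _; rewrite rmorphM /lam 2!rmorph_sum mulr_suml.
  apply: eq_bigr => i /eqP <-; rewrite rf_scaleE mulrCA; congr (_ * _).
  under [in RHS]eq_bigl => T do rewrite -[T != set0]andbT -(subsetT T).
  rewrite rmorph_prod -prodfV -big_split /=; apply: eq_bigr => T /andP[T0 _].
  apply: (canRL (mulfK _)); first by rewrite expf_neq0 ?rf_fgl_neq0.
  by rewrite rmorphXn /= -cE -exprD subnK // -ltnS.
rewrite (partition_big (fun i : 'I_(size r) => c (e i)) (chain_on setT)) //=.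
rewrite big1 // => d /lam0 d0.
have [i0 /eqP i0d|none] := pickP (fun i : 'I_(size r) => c (e i) == d); last first.
  by rewrite big_pred0.
rewrite -[RHS](scale0r (monom nu Q (e i0).2.1 (e i0).2.2)) -d0 scaler_suml.
apply: eq_bigr => i /eqP id; congr (_ *: _); apply: (monom_multichain rbP) => T.
by rewrite -!cE i0d id.
Qed.

End RationalFunctions.

(** * The morphism from [RB] and its image *)

Lemma hom0 (k : fieldType) (P Q : operad k) (f : operad_hom P Q) n : f n 0 = 0.
Proof.
by have := hom_linear f (-1) (0 : P n) 0; rewrite scaler0 addr0 scaleN1r addNr.
Qed.

Lemma hom_word (k : fieldType) (P Q : operad k) (f : operad_hom P Q) mu R n a :
  f n (word mu R n a) = word (f 1%N mu) (f 0%N R) n a.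
Proof.
have f_iter m q (x : P m) : f m (iter q (ap_R R (n := m)) x) =
    iter q (ap_R (f 0%N R) (n := m)) (f m x).
  by elim: q => // q IHq; rewrite !iterS -IHq; apply: (@hom_comp _ _ _ f 0 m).
elim: n a => [|n IHn] a; first by rewrite [LHS]f_iter hom_id.
rewrite !wordS -IHn f_iter; congr (iter _ _ _).
exact: (@hom_comp _ _ _ f 1 n).
Qed.

Lemma RB_hom_RatFct_inj (k : fieldType) (theta : k)
    (f : operad_hom (RB theta) (RatFct theta)) :
    f 1%N (RB_mul theta) = RatFct_mu theta -> f 0%N (RB_op theta) = RatFct_R theta ->
  forall n, injective (f n).
Proof.
move=> f_mul f_op n x y fxy; apply/eqP; rewrite -subr_eq0; apply/eqP.
have : f n (x - y) = 0.
  by rewrite addrC -scaleN1r (hom_linear f) fxy scaleN1r addNr.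
have [r ->] := rb_span_monom_comb (RB_span (x - y)) => sum0.
apply: (monom_sum_eq0 (RB_is_rota_baxter theta)); rewrite -[RHS]sum0.
elim: r {sum0} => [|p r IHr]; first by rewrite !big_nil hom0.
rewrite !big_cons IHr (hom_linear f); congr (_ *: _ + _).
by rewrite /monom (hom_act f) hom_word f_mul f_op.
Qed.

Section GeneratedHom.
Variables (k : fieldType) (theta : k) (P : operad k) (mu : P 1) (R : P 0).
Hypothesis rbP : is_rota_baxter theta mu R.
Let gen := generated_suboperad (RB_family mu R).

Lemma generated_mul : gen 1%N mu.
Proof. by move=> S gS; apply: (gS _ RBmu). Qed.

Lemma generated_op : gen 0%N R.
Proof. by move=> S gS; apply: (gS _ RBop). Qed.

Definition compose_sub_val (Q : operad k) (S : suboperad P)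
  (f : operad_hom Q (suboperad_operad S)) : operad_hom Q P.
Proof.
refine (@OperadHom k Q P (fun n x => sub_val (f n x)) _ _ _ _).
- by move=> n a x y; rewrite (hom_linear f).
- by rewrite hom_id.
- by move=> n s x; rewrite hom_act.
- by move=> m n i x y; rewrite hom_comp.
Defined.

Lemma generated_hom_exists : exists f : operad_hom (RB theta) (suboperad_operad gen),
  [/\ sub_val (f 1%N (RB_mul theta)) = mu, sub_val (f 0%N (RB_op theta)) = R &
      forall n (y : suboperad_operad gen n), exists x, f n x = y].
Proof.
have rb_gen : is_rota_baxter (P := suboperad_operad gen) theta
    (sub_in generated_mul) (sub_in generated_op).
  by have [muC muA rb] := rbP; split; apply: val_inj.
have [f [f_mul f_op] _] := RB_universal rb_gen.
exists f; split=> [||n y]; rewrite ?f_mul ?f_op //.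
pose img n (z : P n) := exists x, sub_val (f n x) = z.
(* The image is a suboperad containing the generators, hence contains the generated one: this is
   surjectivity. *)
have img_sub : exists S : suboperad P, forall n z, S n z <-> img n z.
  unshelve eexists (@Suboperad k P img _ _ _ _ _) => //.
  - by move=> m; exists 0; rewrite hom0.
  - by move=> m a _ _ [x <-] [x' <-]; exists (a *: x + x'); rewrite (hom_linear f).
  - by exists (op_id _); rewrite hom_id.
  - by move=> m s _ [x <-]; exists (op_act s x); rewrite hom_act.
  - by move=> m l i _ _ [x <-] [x' <-]; exists (op_comp i x x'); rewrite hom_comp.
have [S SE] := img_sub.
have [] := iffLR (SE n (sub_val y)); last by move=> x xE; exists x; apply: val_inj.
apply: (sub_carP y) => m [] /=; apply/SE.
  by exists (RB_mul theta); rewrite f_mul.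
by exists (RB_op theta); rewrite f_op.
Qed.

End GeneratedHom.

Unset Implicit Arguments.

Theorem theoremA2 (k : fieldType) (hk : [pchar k] =i pred0) (theta : k) :
  is_rota_baxter theta (RatFct_mu theta) (RatFct_R theta) /\
  exists phi : operad_hom (RB theta) (RatFct theta),
    [/\ phi 1%N (RB_mul theta) = RatFct_mu theta,
        phi 0%N (RB_op theta) = RatFct_R theta &
        exists psi : operad_hom (RB theta)
            (suboperad_operad (generated_suboperad
               (RB_family (RatFct_mu theta) (RatFct_R theta)))),
          operad_iso psi /\
          forall (n : nat) (x : RB theta n), sub_val (psi n x) = phi n x].
Proof.
have rb := RatFct_rota_baxter theta; split=> //.
have [psi [psi_mul psi_op psi_surj]] := generated_hom_exists rb.
exists (compose_sub_val psi); split=> //; exists psi; split=> // n.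
(* The composite of [psi] with the inclusion sends generators to generators, so it is injective, and
   then so is [psi]. *)
have psi_inj : injective (psi n).
  move=> x y xy; apply: (@RB_hom_RatFct_inj _ _ (compose_sub_val psi)) => //=.
  by rewrite xy.
have /choice[g gK] := psi_surj n.
by exists g => // x; apply: psi_inj.
Qed.
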